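(* Let $A:=\log(4/3)/(2\zeta(2))$ and let $\mathcal{G}$ be the limiting gap distribution of the sets $\mathscr{S}_Q$ of $\operatorname{SL}(2,\mathbb{N})$-saturated Farey fractions, $\mathcal{G}(\lambda)=\lim_{Q\to\infty}\mathcal{G}_Q(\lambda)$. Then $\mathcal{G}(\lambda)=0$ for every $\lambda\in[0,A]$.
   Context: $Q$ denotes a positive integer. Let $\mathcal{S}$ be the set of matrices $\begin{pmatrix} a&b\\ c&d\end{pmatrix}\in\operatorname{SL}(2,\mathbb{Z})$ with $a\ge b\ge d\ge 1$ and $a\ge c\ge d$, and let $\mathcal{S}_Q=\{M\in\mathcal{S}:\operatorname{Tr}M\le Q\}$. The set of $\operatorname{SL}(2,\mathbb{N})$-saturated Farey fractions of order $Q$ is $\mathscr{S}_Q:=\left\{d/b:\begin{pmatrix} a&b\\ c&d\end{pmatrix}\in\mathcal{S}_Q\right\}\subset\mathbb{Q}\cap(0,1]$ (without multiplicity), and $N(Q):=\#\mathscr{S}_Q$. For $\lambda\ge0$, $$\mathcal{G}_Q(\lambda):=\frac{\#\{\gamma_1<\gamma_2\ \text{consecutive in }\mathscr{S}_Q:\ \gamma_2-\gamma_1\le\lambda/N(Q)\}}{N(Q)}.$$ $\zeta$ is the Riemann zeta function. The claim includes that the limit exists for these $\lambda$. *)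

(* Defs.v *)
From HB Require Import structures.
From mathcomp Require Import all_boot all_order all_algebra.
From mathcomp Require Import finmap.
From mathcomp Require Import all_classical all_reals all_analysis.

Set Implicit Arguments.
Unset Strict Implicit.
Unset Printing Implicit Defensive.

Import Order.TTheory GRing.Theory Num.Theory.
Import numFieldNormedType.Exports.

Local Open Scope classical_set_scope.
Local Open Scope ring_scope.

(* Only meaningful for [1 < s], where the series converges. *)
Definition zeta {R : realType} (s : R) : R :=
  limn (series (fun n : nat => (n.+1%:R `^ s)^-1)).

(* Rows and columns are indexed from 0:
   a = M 0 0, b = M 0 1, c = M 1 0, d = M 1 1. *)
Definition sat_mx : set 'M[int]_2 :=
  [set M : 'M[int]_2 |
    [/\ \det M = 1,
        M 0 0 >= M 0 1, M 0 1 >= M 1 1, M 1 1 >= 1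
      & M 0 0 >= M 1 0 /\ M 1 0 >= M 1 1]].

Definition sat_mx_le (Q : nat) : set 'M[int]_2 :=
  [set M : 'M[int]_2 | sat_mx M /\ \tr M <= Q%:Z].

Definition sat_farey (Q : nat) : set rat :=
  [set (M 1 1)%:Q / (M 0 1)%:Q | M in sat_mx_le Q].

Definition consecutive (S : set rat) : set (rat * rat) :=
  [set p : rat * rat |
    [/\ S p.1, S p.2, p.1 < p.2 & forall x, S x -> ~ (p.1 < x < p.2)]].

(* [fset_set] sends infinite sets to the empty one; finiteness of the sets
   counted below is [finite_sat_farey] and [finite_sat_small_gaps]. *)
Definition sat_card (Q : nat) : nat := #|` fset_set (sat_farey Q)|.

Definition sat_small_gaps {R : realType} (Q : nat) (lambda : R) :
    set (rat * rat) :=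
  [set p : rat * rat |
    consecutive (sat_farey Q) p /\
    ratr (p.2 - p.1) <= lambda / (sat_card Q)%:R].

Definition gap_distr {R : realType} (Q : nat) (lambda : R) : R :=
  #|` fset_set (sat_small_gaps Q lambda)|%:R / (sat_card Q)%:R.

Definition limit_gap_distr {R : realType} (lambda : R) : R :=
  limn (fun Q : nat => gap_distr Q lambda).

Lemma finite_sat_farey (Q : nat) : finite_set (sat_farey Q).
Proof.
pose f (p : 'I_Q.+1 * 'I_Q.+1) : rat := (p.2 : nat)%:Z%:Q / (p.1 : nat)%:Z%:Q.
apply: (@sub_finite_set _ _ (f @` setT)); last first.
  exact/finite_image/finite_finset.
move=> _ [M [[_ ab bd d1 _] trM] <-].
have {}trM : M 0 0 + M 1 1 <= Q%:Z.
  move: trM; rewrite /mxtrace big_ord_recl big_ord1.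
  by rewrite (_ : lift ord0 ord0 = 1) //; apply/val_inj.
have d0 : 0 <= M 1 1 by apply: le_trans d1.
have b0 : 0 <= M 0 1 by apply: le_trans bd.
have bQ : M 0 1 <= Q%:Z.
  by apply: le_trans ab _; apply: le_trans trM; rewrite lerDl.
have hb : (`|M 0%R 1%R| < Q.+1)%N by rewrite ltnS -lez_nat gez0_abs.
have hd : (`|M 1%R 1%R| < Q.+1)%N.
  by rewrite ltnS -lez_nat gez0_abs //; apply: le_trans bQ.
exists (Ordinal hb, Ordinal hd) => //.
by rewrite /f /=; congr (_%:~R / _%:~R); rewrite gez0_abs.
Qed.

Lemma finite_sat_small_gaps {R : realType} (Q : nat) (lambda : R) :
  finite_set (sat_small_gaps Q lambda).
Proof.
apply: (@sub_finite_set _ _ (sat_farey Q `*` sat_farey Q)).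
  by move=> p [[]].
by apply: finite_setX; exact: finite_sat_farey.
Qed.

(* Main.v *)
Require Import Defs.
From HB Require Import structures.
From mathcomp Require Import all_boot all_order all_algebra all_field cyclic finmap.
From mathcomp Require Import all_classical all_reals all_analysis.
From mathcomp Require Import ring lra zify.

Set Implicit Arguments.
Unset Strict Implicit.
Unset Printing Implicit Defensive.

Import Order.TTheory GRing.Theory Num.Theory.
Import numFieldNormedType.Exports.

(** The fraction d/b is saturated of order Q exactly when b + d + y <= Q, where
    y in [1, b] is the inverse of d modulo b: the smallest admissible a is b + y.
    Kloosterman's bound (a fourth moment, no Weil bound) makes (d/b, y/b)
    equidistributed in the unit square, so that N(Q) >= (A - o(1)) Q^2 with
    A = (1/zeta(2)) * the integral over u, v in [0,1] of 1/(2 (1 + u + v)^2).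
    Two consecutive fractions d/b < d'/b' differ by at least 1/(b b') >= 1/(b Q);
    a gap at most A/N(Q) <= (1 + o(1))/Q^2 therefore forces b >= (1 - o(1)) Q, and
    then d <= Q - b = o(Q), which leaves only o(Q^2) = o(N(Q)) gaps. *)

(** * Divisor counts *)

(** At the endpoint lambda = A the lower bound for N(Q) must carry the exact constant: a fixed loss
    in it would leave a positive proportion of denominators open to small gaps. Lower-order accuracy
    is free, however: every error may be a fixed small multiple of Q^2. The moduli b are arbitrary
    integers, so the zero divisors of Z/b enlarge the fourth moment. The excess is a factor of order
    tau(b)^2, whose sum over b <= Q is o(Q^2); this is why divisor counts come in. The points (d, y)
    are counted with products of tent functions on a grid of mesh about b / (k + 1). Their Fourier
    coefficients are nonnegative with known total mass, so the fourth moment can enter through a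
    termwise inequality with a free parameter q. The grid k is chosen to approximate the integral,
    then q, then a cut D for the divisor sum, all before Q grows. *)

Definition tau (b : nat) : nat := \sum_(d < b.+1) (d %| b).

Lemma tauE (b : nat) : 0 < b -> tau b = \sum_(1 <= d < b.+1) (d %| b).
Proof.
move=> b0; rewrite /tau -(big_mkord xpredT (fun d => nat_of_bool (d %| b))).
by rewrite big_ltn // dvd0n; case: b b0.
Qed.

Definition small_divisors (b : nat) : nat :=
  \sum_(1 <= d < b.+1) ((d %| b) && (d * d <= b)).

Lemma sum_nat_le1 (m k : nat) (P : pred nat) :
  (forall d e, P d -> P e -> d = e) -> \sum_(m <= d < k) P d <= 1.
Proof.
move=> uniqP; case: (pickP [pred i : 'I_k | P i && (m <= i)]) => [i /= /andP[Pi mi]|none].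
  rewrite (bigD1_seq (i : nat)) ?iota_uniq ?mem_index_iota ?mi ?ltn_ord //= Pi big1 // => d di.
  by case Pd: (P d) => //; rewrite (uniqP _ _ Pd Pi) eqxx in di.
rewrite big_nat big1 // => d /andP[md dk].
by have := none (Ordinal dk); rewrite /= md andbT => ->.
Qed.

(** The map d -> b / d carries the divisors with d^2 > b to divisors e with e^2 <= b; the double sum
    over pairs d e = b records this exchange. *)
Lemma tau_le_small_divisors (b : nat) : 0 < b -> tau b <= 2 * small_divisors b.
Proof.
move=> b0; rewrite tauE // mul2n -addnn.
apply: (@leq_trans (small_divisors b +
   \sum_(1 <= d < b.+1) \sum_(1 <= e < b.+1) ((d * e == b) && (e * e <= b)))).
  rewrite /small_divisors -big_split /= big_nat [leqRHS]big_nat; apply: leq_sum => d /andP[d0 _].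
  have [dvd|//] := boolP (d %| b); have [//|lt] := leqP (d * d) b.
  have e0 : 0 < b %/ d by rewrite divn_gt0 // dvdn_leq.
  have eb : b %/ d < b.+1 by rewrite ltnS leq_div.
  rewrite (bigD1_seq (b %/ d)) ?iota_uniq ?mem_index_iota ?e0 //=.
  rewrite mulnC divnK // eqxx /=.
  have E := divnK dvd; rewrite [X in nat_of_bool X](_ : _ = true) //; nia.
rewrite leq_add2l exchange_big /= /small_divisors big_nat [leqRHS]big_nat.
apply: leq_sum => e /andP[e0 _].
have [le|gt] := leqP (e * e) b; last by rewrite big1 // => d _; rewrite andbF.
rewrite andbT; have [dvd|ndvd] := boolP (e %| b); last first.
  by rewrite big1 // => d _; case: eqP => // E; rewrite -E dvdn_mull in ndvd.
under eq_bigr do rewrite andbT.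
apply: (@sum_nat_le1 1 b.+1 (fun d => d * e == b)) => d d' /eqP E /eqP E'.
by apply/eqP; rewrite -(eqn_pmul2r e0) E E'.
Qed.

(* The sum of a set of n positive integers is at least n (n + 1) / 2. *)
Lemma count_sq_le (P : pred nat) (n : nat) :
  (\sum_(1 <= d < n.+1) P d) ^ 2 <= 2 * \sum_(1 <= d < n.+1) P d * d.
Proof.
elim: n => [|n IH]; first by rewrite !big_geq.
rewrite big_nat_recr // [in leqRHS]big_nat_recr //=.
have : \sum_(1 <= d < n.+1) P d <= n.
  rewrite -{2}[n]card_ord -sum1_card big_add1 big_mkord.
  by apply: leq_sum => i _; exact: leq_b1.
move: IH; rewrite -!mulnn.
move: (\sum_(1 <= d < n.+1) P d) (\sum_(1 <= d < n.+1) P d * d) => x S.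
by case: (P n.+1); rewrite /= ?mul1n ?mul0n; nia.
Qed.

Lemma sum_multiples (Q d : nat) : 0 < d -> \sum_(1 <= b < Q.+1) (d %| b) = Q %/ d.
Proof.
move=> d0; elim: Q => [|Q IH]; first by rewrite big_geq // div0n.
by rewrite big_nat_recr //= IH divnS // addnC.
Qed.

(* A divisor d with d^2 <= Q satisfies d <= D or d <= Q / D. *)
Lemma sum_tau_sq (Q D : nat) : 0 < D ->
  \sum_(1 <= b < Q.+1) tau b ^ 2 <= 8 * (Q * (D + Q %/ D)).
Proof.
move=> D0.
(* tau(b)^2 is at most 4 times the square of [small_divisors b], hence at most 8 times the sum of
   the divisors d with d^2 <= b. After exchanging the sums, each d contributes at most d (Q / d) <=
   Q. *)
apply: (@leq_trans (8 * \sum_(1 <= b < Q.+1) \sum_(1 <= d < Q.+1) ((d %| b) && (d * d <= b)) * d)).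
  rewrite big_distrr /= big_nat [leqRHS]big_nat; apply: leq_sum => b /andP[b0 bQ].
  have t := tau_le_small_divisors b0.
  have s := count_sq_le (fun d => (d %| b) && (d * d <= b)) b.
  apply: (@leq_trans (8 * \sum_(1 <= d < b.+1) ((d %| b) && (d * d <= b)) * d)).
    rewrite -/(small_divisors b) in s; rewrite -!mulnn in s *; nia.
  by rewrite leq_mul2l (@big_cat_nat _ _ _ b.+1 1 Q.+1) //= leq_addr.
rewrite leq_mul2l /= exchange_big /=.
apply: (@leq_trans (\sum_(1 <= d < Q.+1) Q * (d * d <= Q))).
  rewrite big_nat [leqRHS]big_nat; apply: leq_sum => d /andP[d0 dQ].
  have [le|gt] := leqP (d * d) Q.
    rewrite muln1 -big_distrl /=; apply: leq_trans (leq_divM Q d).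
    rewrite leq_mul2r -(sum_multiples Q d0); apply/orP; right.
    by apply: leq_sum => b _; case: (d %| b) => //=; exact: leq_b1.
  rewrite muln0 big_nat big1 // => b /andP[_ bQ].
  by rewrite leqNgt (leq_trans _ gt) // andbF.
rewrite -big_distrr leq_mul2l /=; apply/orP; right.
apply: (@leq_trans (\sum_(1 <= d < Q.+1) ((d <= D) + (d <= Q %/ D)))).
  rewrite big_nat [leqRHS]big_nat; apply: leq_sum => d /andP[d0 _].
  have [le|//] := leqP (d * d) Q; have [//|Dd] := leqP d D.
  by rewrite leq_divRL // (leq_trans _ le) // leq_mul2l ltnW ?orbT.
have cnt m : \sum_(1 <= d < Q.+1) (d <= m) <= m.
  have [mQ|Qm] := leqP m Q.
    rewrite (@big_cat_nat _ _ _ m.+1) //= [X in _ + X]big_nat [X in _ + X]big1 ?addn0.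
      rewrite -{3}[m]card_ord -sum1_card big_add1 big_mkord.
      by apply: leq_sum => i _; exact: leq_b1.
    by move=> i /andP[mi _]; rewrite leqNgt mi.
  apply: leq_trans (ltnW Qm); rewrite -{2}[Q]card_ord -sum1_card big_add1 big_mkord.
  by apply: leq_sum => i _; exact: leq_b1.
by rewrite big_split /= leq_add ?cnt.
Qed.

Local Open Scope ring_scope.

(** * Kloosterman sums over a finite ring *)

Section Kloosterman.
Variable R : finComUnitRingType.

Definition ann (a : R) : nat := (\sum_(x : R) (a * x == 0)%R)%N.
Definition ann_total : nat := (\sum_(a : R) ann a)%N.
Definition nunits : nat := (\sum_(x : R | x \is a GRing.unit) 1)%N.

(** Autocorrelation of the indicator of [I]: a tent function when [I] is an interval. Its Fourier
    transform is a squared modulus, hence nonnegative. *)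
Definition diff_count (I : {set R}) (y : R) : nat :=
  (\sum_(i in I) \sum_(j in I) (i - j == y)%R)%N.
(** Weighted number of points of the hyperbola x y = 1 near (u, v). *)
Definition inv_count (I : {set R}) (u v : R) : nat :=
  (\sum_(x : R | x \is a GRing.unit)
     diff_count I (x - u)%R * diff_count I (x^-1 - v)%R)%N.

(** A nonempty solution set is a translate of the annihilator of [a]. *)
Lemma linear_count (a c : R) : (\sum_(x : R) (a * x == c)%R <= ann a)%N.
Proof.
case: (pickP [pred x : R | a * x == c]) => [x0 /= /eqP ax0|nx]; last first.
  by rewrite big1 // => x _; have := nx x => /= ->.
rewrite /ann (reindex_inj (addrI x0)) /=.
by apply: leq_sum => x _; rewrite mulrDr ax0 -subr_eq0 addrC addKr.
Qed.

(** Multiplication by [b] maps the annihilator of a b into that of [a], with fibres bounded by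
    [linear_count]. *)
Lemma annM (a b : R) : (ann (a * b)%R <= ann a * ann b)%N.
Proof.
rewrite {1}/ann.
have -> : (\sum_(x : R) (a * b * x == 0)%R =
           \sum_(y : R) \sum_(x : R) (a * y == 0)%R * (b * x == y)%R)%N.
  rewrite exchange_big /=; apply: eq_bigr => x _.
  rewrite (bigD1 (b * x)) //= eqxx muln1 big1 ?addn0 ?mulrA // => y ny.
  by rewrite [b * x == y]eq_sym (negbTE ny) muln0.
rewrite /ann big_distrl /=; apply: leq_sum => y _.
by rewrite -big_distrr /= leq_mul2l linear_count orbT.
Qed.

(** Additive energy of the points (x, 1/x); orthogonality makes it the fourth moment of the
    Kloosterman sums divided by #|R|^2. *)
Definition inv_quadruples : nat :=
  (\sum_(x1 : R | x1 \is a GRing.unit) \sum_(x2 : R | x2 \is a GRing.unit)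
   \sum_(x3 : R | x3 \is a GRing.unit) \sum_(x4 : R | x4 \is a GRing.unit)
     ((x1 + x2 == x3 + x4) && (x1^-1 + x2^-1 == x3^-1 + x4^-1))%R)%N.

(* Given x1 + x2 = x3 + x4, the second factor is x1 x2 - x3 x4. *)
Lemma inv_quadruple_eq0 (x1 x2 x3 x4 : R) :
  x1 \is a GRing.unit -> x2 \is a GRing.unit -> x3 \is a GRing.unit ->
  x4 \is a GRing.unit -> x1 + x2 = x3 + x4 ->
  x1^-1 + x2^-1 = x3^-1 + x4^-1 ->
  (x1 + x2) * ((x3 - x1) * (x3 - x2)) = 0.
Proof.
move=> U1 U2 U3 U4 E1 E2.
have E3 : (x1 + x2) * (x3 * x4) = (x3 + x4) * (x1 * x2).
  have -> : x3 + x4 = (x3 * x4) * (x3^-1 + x4^-1).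
    by rewrite mulrDr mulrAC divrr // mul1r mulrK // addrC.
  have -> : x1 + x2 = (x1 * x2) * (x1^-1 + x2^-1).
    by rewrite mulrDr mulrAC divrr // mul1r mulrK // addrC.
  by rewrite E2 mulrAC [RHS]mulrAC (mulrC (x1 * x2)).
have -> : (x3 - x1) * (x3 - x2) = x1 * x2 - x3 * x4.
  have -> : x4 = x1 + x2 - x3 by rewrite E1 addrC addKr.
  ring.
by rewrite mulrBr E3 E1 subrr.
Qed.

(** With a = x3 - x1 and b = x3 - x2, the equation of [inv_quadruple_eq0] becomes 2 a b x3 = a b (a
    + b), linear in x3. It has at most ann(2) ann(a) ann(b) solutions, and the hypothesis gives
    ann(2) <= 2. *)
Lemma inv_quadruples_le : (forall c : R, (\sum_(x : R) (2%:R * x == c)%R <= 2)%N) ->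
  (inv_quadruples <= 2 * ann_total ^ 2)%N.
Proof.
move=> two.
pose F (x1 x2 x3 : R) : nat := ((x1 + x2) * ((x3 - x1) * (x3 - x2)) == 0)%R.
have step1 : (inv_quadruples <= \sum_(x1 : R) \sum_(x2 : R) \sum_(x3 : R) F x1 x2 x3)%N.
  rewrite /inv_quadruples big_mkcond /=; apply: leq_sum => x1 _.
  case: ifP => // U1; rewrite big_mkcond /=; apply: leq_sum => x2 _.
  case: ifP => // U2; rewrite big_mkcond /=; apply: leq_sum => x3 _.
  case: ifP => // U3; rewrite big_mkcond /=.
  rewrite (bigD1 (x1 + x2 - x3)) //= big1 ?addn0 => [|x4 ne]; last first.
    case: ifP => // _; case: eqP => //= E; case/eqP: ne.
    by rewrite E addrC addKr.
  case: ifP => // U4; case: eqP => //= E1; case: eqP => //= E2.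
  by rewrite /F (inv_quadruple_eq0 U1 U2 U3 U4 E1 E2) eqxx.
apply: (leq_trans step1).
have -> : (\sum_(x1 : R) \sum_(x2 : R) \sum_(x3 : R) F x1 x2 x3 =
  \sum_(a : R) \sum_(b : R) \sum_(x : R) (2%:R * (a * b) * x == a * b * (a + b))%R)%N.
  under eq_bigr => x1 _ do rewrite exchange_big.
  rewrite exchange_big /= [RHS]exchange_big /=.
  transitivity (\sum_(x : R) \sum_(a : R) \sum_(b : R)
      (2%:R * (a * b) * x == a * b * (a + b))%R)%N; last first.
    by rewrite exchange_big [RHS]exchange_big /=; apply: eq_bigr => a _; rewrite exchange_big.
  apply: eq_bigr => x _.
  rewrite (reindex_inj (inj_comp (addrI x) oppr_inj)) /=; apply: eq_bigr => a _.
  rewrite (reindex_inj (inj_comp (addrI x) oppr_inj)) /=; apply: eq_bigr => b _.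
  rewrite /F -[in RHS]subr_eq0; congr (nat_of_bool (_ == _)); ring.
rewrite -mulnn big_distrlr big_distrr /=; apply: leq_sum => a _.
rewrite big_distrr /=; apply: leq_sum => b _.
apply: leq_trans (linear_count _ _) _; apply: leq_trans (annM _ _) _.
by apply: leq_mul; [exact: two | exact: annM].
Qed.

(** * Fourth moment of Kloosterman sums *)

Variable e : R -> algC.
Hypothesis eD : forall x y, e (x + y) = e x * e y.
Hypothesis e_norm : forall x, `|e x| = 1.
Hypothesis e_sum : forall a, \sum_(x : R) e (a * x) = (a == 0)%:R * #|R|%:R.

Definition kloosterman (m n : R) : algC :=
  \sum_(x : R | x \is a GRing.unit) e (m * x + n * x^-1).

Lemma e_neq0 x : e x != 0.
Proof. by rewrite -normr_eq0 e_norm oner_eq0. Qed.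

Lemma e0 : e 0 = 1.
Proof. by apply: (mulfI (e_neq0 0)); rewrite -eD addr0 mulr1. Qed.

Lemma e_conj x : (e x)^* = e (- x).
Proof.
apply: (mulfI (e_neq0 x)).
by rewrite -eD subrr e0 -normCK e_norm expr1n.
Qed.

Lemma kloosterman_unit t m n : t \is a GRing.unit ->
  kloosterman (t * m) (t^-1 * n) = kloosterman m n.
Proof.
move=> Ut; rewrite /kloosterman [RHS](reindex_inj (mulrI Ut)) /=.
apply: eq_big => x; first by rewrite unitrM Ut.
by move=> Ux; rewrite invrM // mulrA (mulrC m) (mulrC x^-1) mulrA (mulrC n).
Qed.

(** After expanding |K|^4, the sum over m imposes x1 + x2 = x3 + x4 and the sum over n imposes the
    same relation on the inverses. *)
Lemma kloosterman_sum4 :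
  \sum_(m : R) \sum_(n : R) `|kloosterman m n| ^+ 4 = (#|R| ^ 2 * inv_quadruples)%:R.
Proof.
have K4 m n : `|kloosterman m n| ^+ 4 =
  \sum_(x1 : R | x1 \is a GRing.unit) \sum_(x2 : R | x2 \is a GRing.unit)
  \sum_(x3 : R | x3 \is a GRing.unit) \sum_(x4 : R | x4 \is a GRing.unit)
   e ((x1 + x2 - (x3 + x4)) * m) * e ((x1^-1 + x2^-1 - (x3^-1 + x4^-1)) * n).
  have -> : `|kloosterman m n| ^+ 4 = (`|kloosterman m n| ^+ 2) ^+ 2.
    by rewrite -exprM.
  rewrite normCK exprMn 2!expr2 -rmorphM /= /kloosterman.
  rewrite !big_distrlr /= rmorph_sum big_distrl /=; apply: eq_bigr => x1 _.
  rewrite big_distrl /=; apply: eq_bigr => x2 _.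
  rewrite big_distrr /=; apply: eq_bigr => x3 _.
  rewrite rmorph_sum big_distrr /=; apply: eq_bigr => x4 _.
  rewrite rmorphM /= !e_conj -!eD; congr (e _); ring.
under eq_bigr => m _ do under eq_bigr => n _ do rewrite K4.
have swap (F : R -> R -> R -> R -> R -> R -> algC) (U : pred R) :
   \sum_m \sum_n \sum_(x1 | U x1) \sum_(x2 | U x2) \sum_(x3 | U x3)
     \sum_(x4 | U x4) F m n x1 x2 x3 x4
   = \sum_(x1 | U x1) \sum_(x2 | U x2) \sum_(x3 | U x3)
     \sum_(x4 | U x4) \sum_m \sum_n F m n x1 x2 x3 x4.
  under eq_bigr => m _ do rewrite exchange_big.
  rewrite exchange_big; apply: eq_bigr => x1 _ /=.
  under eq_bigr => m _ do rewrite exchange_big.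
  rewrite exchange_big; apply: eq_bigr => x2 _ /=.
  under eq_bigr => m _ do rewrite exchange_big.
  rewrite exchange_big; apply: eq_bigr => x3 _ /=.
  under eq_bigr => m _ do rewrite exchange_big.
  by rewrite exchange_big.
rewrite swap natrM /inv_quadruples.
do 4 (rewrite natr_sum big_distrr /=; apply: eq_bigr => ? _).
under eq_bigr => m _ do rewrite -big_distrr /= e_sum.
rewrite -big_distrl /= e_sum !subr_eq0.
by rewrite -!natrM mulnACA mulnn mulnb mulnC.
Qed.

(** * Nonnegative Fourier weights and the hyperbola *)

Variable I : {set R}.
(** Pairs whose difference is killed by m are at most the diagonal plus the proportion ann(m) / #|R|
    expected at random. *)
Hypothesis I_spread : forall m : R, m != 0 ->
  (#|R| * (\sum_(i in I) \sum_(j in I) (m * (i - j) == 0)%R)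
    <= #|R| * #|I| + ann m * #|I| ^ 2)%N.

Definition fourier_sq (m : R) : algC := `|\sum_(i in I) e (m * i)| ^+ 2.

Lemma fourier_sqE m :
  fourier_sq m = \sum_(i in I) \sum_(j in I) e (m * (i - j)).
Proof.
rewrite /fourier_sq normCK rmorph_sum big_distrlr /=.
apply: eq_bigr => i _; apply: eq_bigr => j _.
by rewrite e_conj -eD mulrBr.
Qed.

Lemma fourier_sq_ge0 m : 0 <= fourier_sq m.
Proof. by rewrite exprn_ge0. Qed.

Lemma fourier_sq0 : fourier_sq 0 = (#|I| ^ 2)%:R.
Proof.
rewrite /fourier_sq; under eq_bigr => i _ do rewrite mul0r e0.
by rewrite sumr_const normr_nat natrX.
Qed.

Lemma fourier_sq_le m : fourier_sq m <= (#|I| ^ 2)%:R.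
Proof.
rewrite /fourier_sq natrX lerXn2r ?nnegrE ?ler0n //.
apply: le_trans (ler_norm_sum _ _ _) _.
by under eq_bigr => i _ do rewrite e_norm; rewrite sumr_const.
Qed.

Lemma fourier_inversion y :
  \sum_m fourier_sq m * e (- (m * y)) = (#|R| * diff_count I y)%:R.
Proof.
under eq_bigr => m _ do rewrite fourier_sqE big_distrl.
rewrite exchange_big natrM /diff_count natr_sum big_distrr /=.
apply: eq_bigr => i _; under eq_bigr => m _ do rewrite big_distrl.
rewrite exchange_big natr_sum big_distrr /=; apply: eq_bigr => j _.
rewrite [RHS]mulrC -subr_eq0 -e_sum; apply: eq_bigr => m _.
by rewrite -eD -mulrBr mulrC.
Qed.

Lemma sum_fourier_sq : \sum_m fourier_sq m = (#|R| * #|I|)%:R.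
Proof.
have := fourier_inversion 0; under eq_bigr do rewrite mulr0 oppr0 e0 mulr1.
move=> ->; congr (_ * _)%:R; rewrite /diff_count -sum1_card.
apply: eq_bigr => i Ii; rewrite (bigD1 i) //= subrr eqxx big1 // => j.
by case/andP=> _ ne; rewrite subr_eq0 eq_sym (negbTE ne).
Qed.

(* The terms t m = 0, which no unit t produces, absorb the main term of
   [I_spread]. *)
Lemma sum_unit_fourier_sq (m : R) : m != 0 ->
  \sum_(t : R | t \is a GRing.unit) fourier_sq (t * m) <= (#|R| * #|I|)%:R.
Proof.
move=> m0.
have tot : \sum_(t : R) fourier_sq (t * m) =
  (#|R| * (\sum_(i in I) \sum_(j in I) (m * (i - j) == 0)%R))%:R.
  rewrite (eq_bigr _ (fun t _ => fourier_sqE (t * m))).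
  rewrite exchange_big natrM natr_sum big_distrr /=.
  apply: eq_bigr => i _; rewrite exchange_big natr_sum big_distrr /=.
  apply: eq_bigr => j _; rewrite [RHS]mulrC -e_sum; apply: eq_bigr => t _.
  by rewrite -mulrA mulrC.
have zer : \sum_(t : R | t * m == 0) fourier_sq (t * m) = (ann m * #|I| ^ 2)%:R.
  under eq_bigr => t /eqP -> do rewrite fourier_sq0.
  rewrite sumr_const -[LHS]mulr_natl -natrM; congr (_ * _)%:R.
  rewrite -sum1_card big_mkcond; apply: eq_bigr => t _.
  rewrite -topredE /= mulrC.
  have cb (b : bool) : (if b then 1%N else 0%N) = b by case: b.
  exact: cb.
have : \sum_(t : R | t * m == 0) fourier_sq (t * m) +
   \sum_(t : R | t \is a GRing.unit) fourier_sq (t * m) <=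
   (ann m * #|I| ^ 2)%:R + (#|R| * #|I|)%:R.
  rewrite -natrD; apply: (@le_trans _ _ (\sum_(t : R) fourier_sq (t * m))).
    rewrite [leRHS](bigID (fun t : R => t * m == 0)) /= lerD2l.
    rewrite [leLHS]big_mkcond [leRHS]big_mkcond /=; apply: ler_sum => t _.
    case: ifP => [Ut|_]; last by case: ifP => // _; exact: fourier_sq_ge0.
    by rewrite -(mulr0 t) (inj_eq (mulrI Ut)) m0.
  by rewrite tot ler_nat addnC I_spread.
by rewrite zer lerD2l.
Qed.

(** The factor with a nonzero frequency is averaged over t and the other is bounded by #|I|^2; t ->
    1/t exchanges the two cases. *)
Lemma sum_unit_fourier_sq2 (m n : R) : (m != 0) || (n != 0) ->
  \sum_(t : R | t \is a GRing.unit) fourier_sq (t * m) * fourier_sq (t^-1 * n)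
    <= (#|R| * #|I| ^ 3)%:R.
Proof.
have -> : (#|R| * #|I| ^ 3 = #|R| * #|I| * #|I| ^ 2)%N by rewrite -mulnA -expnS.
rewrite natrM; case/orP => nz.
  apply: (@le_trans _ _ (\sum_(t : R | t \is a GRing.unit)
     fourier_sq (t * m) * (#|I| ^ 2)%:R)).
    apply: ler_sum => t _; apply: ler_wpM2l; first exact: fourier_sq_ge0.
    exact: fourier_sq_le.
  rewrite -big_distrl /=; apply: ler_wpM2r; first by rewrite ler0n.
  exact: sum_unit_fourier_sq.
apply: (@le_trans _ _ (\sum_(t : R | t \is a GRing.unit)
     fourier_sq (t^-1 * n) * (#|I| ^ 2)%:R)).
  apply: ler_sum => t _; rewrite mulrC.
  by apply: ler_wpM2l; [exact: fourier_sq_ge0 | exact: fourier_sq_le].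
rewrite -big_distrl /=; apply: ler_wpM2r; first by rewrite ler0n.
rewrite (reindex_inj invr_inj) /=.
under eq_big => [t|t _] do [rewrite unitrV | rewrite invrK].
exact: sum_unit_fourier_sq.
Qed.

(* K(m, n) is constant on the orbits (t m, t^-1 n), so the Fourier weights may
   be averaged over t. *)
Lemma fourier_kloosterman4 :
  nunits%:R * (\sum_(m : R) \sum_(n : R | (m != 0) || (n != 0))
    fourier_sq m * fourier_sq n * `|kloosterman m n| ^+ 4)
  <= (#|R| * #|I| ^ 3 * (#|R| ^ 2 * inv_quadruples))%:R.
Proof.
have -> : nunits%:R * (\sum_(m : R) \sum_(n : R | (m != 0) || (n != 0))
    fourier_sq m * fourier_sq n * `|kloosterman m n| ^+ 4) =
  \sum_(m : R) \sum_(n : R | (m != 0) || (n != 0))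
   (\sum_(t : R | t \is a GRing.unit) fourier_sq (t * m) * fourier_sq (t^-1 * n))
     * `|kloosterman m n| ^+ 4.
  under [RHS]eq_bigr => m _ do
    (under eq_bigr => n _ do rewrite big_distrl; rewrite exchange_big).
  rewrite exchange_big /= /nunits natr_sum big_distrl /=.
  apply: eq_bigr => t Ut; rewrite mul1r (reindex_inj (mulrI Ut)) /=.
  apply: eq_bigr => m _.
  have Ut' : t^-1 \is a GRing.unit by rewrite unitrV.
  rewrite (reindex_inj (mulrI Ut')) /=; apply: eq_big => n.
    have unit_eq0 (s k : R) : s \is a GRing.unit -> (s * k == 0) = (k == 0).
      by move=> Us; rewrite -{1}(mulr0 s) (inj_eq (mulrI Us)).
    by rewrite !unit_eq0.
  by rewrite kloosterman_unit.
rewrite natrM -kloosterman_sum4 big_distrr /=; apply: ler_sum => m _.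
rewrite big_distrr /= [leLHS]big_mkcond /=; apply: ler_sum => n _.
case: ifP => [nz|_]; last by rewrite mulr_ge0 ?ler0n ?exprn_ge0.
by apply: ler_wpM2r; [rewrite exprn_ge0 | exact: sum_unit_fourier_sq2].
Qed.

(** Inverting both autocorrelations and summing over the units produces Kloosterman sums. The center
    (u, v) survives only as a phase of modulus 1, so later bounds are uniform in it. *)
Lemma inv_count_fourier u v : (#|R| ^ 2 * inv_count I u v)%:R =
  \sum_(m : R) \sum_(n : R)
    fourier_sq m * fourier_sq n * kloosterman (- m) (- n) * e (m * u + n * v).
Proof.
rewrite natrM natrX /inv_count natr_sum big_distrr /=.
under [RHS]eq_bigr => m _ do
  (under eq_bigr => n _ do rewrite /kloosterman mulrAC big_distrr; rewrite exchange_big).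
rewrite exchange_big /=; apply: eq_bigr => x Ux.
rewrite natrM expr2 mulrACA -[X in X * _]natrM -[X in _ * X]natrM.
rewrite -!fourier_inversion big_distrlr /=.
apply: eq_bigr => m _; apply: eq_bigr => n _.
by rewrite mulrACA -eD -[RHS]mulrA -eD; congr (_ * e _); ring.
Qed.

Lemma kloosterman00 : kloosterman 0 0 = nunits%:R.
Proof.
rewrite /kloosterman /nunits natr_sum; apply: eq_bigr => x _.
by rewrite !mul0r addr0 e0.
Qed.

Lemma kloostermanN m n : `|kloosterman (- m) (- n)| = `|kloosterman m n|.
Proof.
rewrite -[RHS]norm_conjC /kloosterman rmorph_sum; congr `|_|.
by apply: eq_bigr => x _; rewrite /= e_conj opprD !mulNr.
Qed.

(** Applied below to y = q |K| / #|R|. The difference is a sum of two squares and 1/2, which avoids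
    comparing y with 1 in the partially ordered [algC]. *)
Lemma le_add1_pow4 (y : algC) : 0 <= y -> y <= 1 + y ^+ 4.
Proof.
move=> y0; rewrite -subr_ge0.
have -> : 1 + y ^+ 4 - y = (y ^+ 2 - 2^-1) ^+ 2 + (y - 2^-1) ^+ 2 + 2^-1 by field.
have yr : y \is Num.real by rewrite ger0_real.
have hr : 2^-1 \is @Num.real algC by rewrite rpredV realn.
by rewrite !addr_ge0 ?invr_ge0 ?ler0n // real_exprn_even_ge0 // rpredB // rpredX.
Qed.

Lemma sum2_split (f : R -> R -> algC) :
  \sum_(m : R) \sum_(n : R) f m n =
  f 0 0 + \sum_(m : R) \sum_(n : R | (m != 0) || (n != 0)) f m n.
Proof.
rewrite (bigD1 (0 : R)) //= (bigD1 (0 : R) (P := xpredT)) //=.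
rewrite [in RHS](bigD1 (0 : R)) //= eqxx /= -addrA; congr (_ + (_ + _)).
apply: eq_bigr => m m0; by under [RHS]eq_bigl => n do rewrite m0.
Qed.

(* The frequency (0, 0) gives the main term; the others are bounded with
   |K| <= B / q + |K|^4 q^3 / B^3, where B = #|R|. *)
Lemma inv_count_lower (q : nat) (u v : R) : (0 < #|R|)%N ->
  (forall c : R, (\sum_(x : R) (2%:R * x == c)%R <= 2)%N) ->
  (q * #|I| ^ 4 * nunits ^ 2 <=
    q * #|R| ^ 2 * inv_count I u v * nunits + #|R| ^ 3 * #|I| ^ 2 * nunits
    + 2 * ann_total ^ 2 * #|I| ^ 3 * q ^ 4)%N.
Proof.
move=> B0 two.
pose S : algC := \sum_(m : R) \sum_(n : R | (m != 0) || (n != 0))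
    fourier_sq m * fourier_sq n * `|kloosterman m n|.
pose S4 : algC := \sum_(m : R) \sum_(n : R | (m != 0) || (n != 0))
    fourier_sq m * fourier_sq n * `|kloosterman m n| ^+ 4.
have h1 : (#|I| ^ 4 * nunits)%:R - (#|R| ^ 2 * inv_count I u v)%:R <= S.
  have [X XE XS] : exists2 X : algC,
      (#|R| ^ 2 * inv_count I u v)%:R = (#|I| ^ 4 * nunits)%:R + X & `|X| <= S.
    rewrite inv_count_fourier sum2_split; eexists.
      congr (_ + _); rewrite !oppr0 kloosterman00 !mul0r addr0 e0 mulr1 fourier_sq0.
      by rewrite -!natrM -expnD.
    apply: le_trans (ler_norm_sum _ _ _) _; apply: ler_sum => m _.
    apply: le_trans (ler_norm_sum _ _ _) _; apply: ler_sum => n _.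
    rewrite normrM e_norm mulr1 normrM kloostermanN ger0_norm //.
    by rewrite mulr_ge0 ?fourier_sq_ge0.
  rewrite XE opprD addrA subrr add0r; apply: le_trans XS.
  (* [X] is a difference of two natural numbers, hence real and comparable with its norm. *)
  rewrite -normrN; apply: real_ler_norm; rewrite rpredN.
  by rewrite -[X](addKr (#|I| ^ 4 * nunits)%:R) -XE rpredD ?rpredN ?realn.
have B1 : #|R|%:R != 0 :> algC by rewrite pnatr_eq0 -lt0n.
have h2 : q%:R * S <= (#|R| ^ 3 * #|I| ^ 2)%:R + q%:R ^+ 4 / #|R|%:R ^+ 3 * S4.
  have tot : \sum_(m : R) \sum_(n : R | (m != 0) || (n != 0))
      #|R|%:R * (fourier_sq m * fourier_sq n) <= (#|R| ^ 3 * #|I| ^ 2)%:R.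
    have -> : (#|R| ^ 3 * #|I| ^ 2 = #|R| * ((#|R| * #|I|) * (#|R| * #|I|)))%N.
      by rewrite mulnn expnMn mulnA -expnS.
    rewrite natrM natrM -sum_fourier_sq big_distrlr big_distrr /=.
    apply: ler_sum => m _; rewrite big_distrr big_mkcond /=.
    apply: ler_sum => n _; case: ifP => // _.
    by rewrite !mulr_ge0 ?fourier_sq_ge0 ?ler0n.
  apply: (le_trans _ (lerD tot (lexx _))).
  rewrite /S /S4 !big_distrr -big_split /=; apply: ler_sum => m _.
  rewrite !big_distrr -big_split /=; apply: ler_sum => n _.
  set w := _ * fourier_sq n; set k := `|_|.
  have -> : #|R|%:R * w + q%:R ^+ 4 / #|R|%:R ^+ 3 * (w * k ^+ 4) =
     w * #|R|%:R * (1 + (q%:R * k / #|R|%:R) ^+ 4) by field.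
  have -> : q%:R * (w * k) = w * #|R|%:R * (q%:R * k / #|R|%:R) by field.
  apply: ler_wpM2l; first by rewrite !mulr_ge0 ?fourier_sq_ge0 ?ler0n.
  by apply: le_add1_pow4; rewrite !mulr_ge0 ?invr_ge0 ?normr_ge0 ?ler0n.
have h3 : nunits%:R * S4 <= (#|R| * #|I| ^ 3 * (#|R| ^ 2 * (2 * ann_total ^ 2)))%:R.
  apply: le_trans fourier_kloosterman4 _.
  by rewrite ler_nat leq_mul2l; rewrite leq_mul2l inv_quadruples_le ?orbT.
have h4 : nunits%:R * (q%:R ^+ 4 / #|R|%:R ^+ 3 * S4) <=
   (2 * ann_total ^ 2 * #|I| ^ 3 * q ^ 4)%:R.
  have -> : (2 * ann_total ^ 2 * #|I| ^ 3 * q ^ 4)%:R =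
    q%:R ^+ 4 / #|R|%:R ^+ 3 * (#|R| * #|I| ^ 3 * (#|R| ^ 2 * (2 * ann_total ^ 2)))%:R :> algC.
    by rewrite !(natrM, natrX); field.
  by rewrite mulrCA; apply: ler_wpM2l h3; rewrite divr_ge0 ?exprn_ge0 ?ler0n.
rewrite -(ler_nat algC) 2!natrD -addrA -lerBlDl.
have -> : (q * #|I| ^ 4 * nunits ^ 2)%:R - (q * #|R| ^ 2 * inv_count I u v * nunits)%:R =
   q%:R * nunits%:R * ((#|I| ^ 4 * nunits)%:R - (#|R| ^ 2 * inv_count I u v)%:R) :> algC.
  by rewrite !(natrM, natrX); ring.
rewrite -lerBlDl; apply: le_trans h4; rewrite lerBlDl.
apply: (@le_trans _ _ (nunits%:R * (q%:R * S))).
  rewrite mulrCA mulrA; apply: ler_wpM2l h1; by rewrite mulr_ge0 ?ler0n.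
rewrite natrM [_%:R * nunits%:R]mulrC -mulrDr.
by apply: ler_wpM2l h2; rewrite ler0n.
Qed.
End Kloosterman.

(** * Modular inverses in boxes *)

Section ModularInverses.
Variable n : nat.
(* 'Z_b is the ring of integers modulo b only for b >= 2. *)
Local Notation b := (n.+2).
Local Notation Zb := 'Z_b.

Lemma card_Zb : #|Zb| = b.
Proof. by rewrite card_ord. Qed.

Lemma Zb_natr_eq (i j : nat) : (i%:R == j%:R :> Zb) = (i == j %[mod b]).
Proof. by rewrite -(inj_eq val_inj) /= !Zp_nat. Qed.

Lemma nunits_Zb : nunits Zb = totient b.
Proof.
rewrite totient_count_coprime big_mkord /nunits big_mkcond.
apply: eq_bigr => x _; rewrite -[x in x \is a _]natr_Zp unitZpE //.
Qed.

(** Take x -> z^x for a primitive b-th root of unity z: if a is nonzero then z^a differs from 1 and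
    the geometric sum vanishes. *)
Lemma Zb_char : {e : Zb -> algC |
  [/\ forall x y, e (x + y) = e x * e y,
      forall x, `|e x| = 1 &
      forall a, \sum_(x : Zb) e (a * x) = (a == 0)%:R * #|Zb|%:R]}.
Proof.
have [z zP] := @C_prim_root_exists b isT.
exists (fun x : Zb => z ^+ x); split.
- by move=> x y; rewrite -exprD /= prim_expr_mod.
- move=> x; suff -> : `|z ^+ x| = `|z| ^+ x by
    rewrite (_ : `|z| = 1) ?expr1n //; apply/eqP;
    rewrite -(@pexpr_eq1 _ _ b) // -normrX (prim_expr_order zP) normr1.
  exact: normrX.
- move=> a; have zM (x : Zb) : z ^+ (a * x)%R = (z ^+ a) ^+ x.
    by rewrite -exprM /= prim_expr_mod.
  under eq_bigr => x _ do rewrite zM.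
  case: eqP => [->|/eqP a0].
    under eq_bigr => x _ do rewrite expr0 expr1n.
    by rewrite sumr_const mul1r.
  rewrite mul0r; apply: (@mulfI _ (z ^+ a - 1)).
    rewrite subr_eq0 -(expr0 z) (eq_prim_root_expr zP).
    by rewrite mod0n modn_small // ; case: (a) (ltn_ord a).
  rewrite mulr0 -[LHS]subrX1 -exprM mulnC exprM (prim_expr_order zP) expr1n.
  by rewrite subrr.
Qed.

(** The kernel of doubling lies in {0, b / 2}. *)
Lemma Zb_two (c : Zb) : (\sum_(x : Zb) (2%:R * x == c)%R <= 2)%N.
Proof.
apply: leq_trans (linear_count _ _) _.
rewrite /ann (@leq_trans (\sum_(x : Zb) ((x == 0%R) + (x == inZp (b./2)))))//.
  apply: leq_sum => x _.
  case: eqP => // /eqP; rewrite -{1}[x]natr_Zp -natrM -[0]/(0%:R) Zb_natr_eq mod0n.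
  have xb : (x < b)%N := ltn_ord x.
  case/dvdnP => -[|[|k]] E; last by exfalso; lia.
    by rewrite (_ : (x == 0) = true) //; apply/eqP/val_inj => /=; lia.
  rewrite [X in (_ < _ + X)%N](_ : _ = 1)%N ?addn1 //.
  rewrite (_ : (x == inZp b./2) = true) //; apply/eqP/val_inj => /=.
  have half y : (y < b -> 2 * y = 1 * b -> y = n./2.+1)%N by lia.
  by rewrite modn_small -(half _ xb E).
rewrite big_split /= (bigD1 (0 : Zb)) //= big1; last by move=> i /negbTE ->.
rewrite (bigD1 (inZp b./2 : Zb)) //= big1; last by move=> i /negbTE ->.
by rewrite !eqxx.
Qed.
End ModularInverses.

Lemma sum_mod_block (r a c : nat) : (0 < r)%N ->
  (\sum_(j < r) (a + j == c %[mod r]) = 1)%N.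
Proof.
case: r => // r _.
pose j0 : 'I_r.+1 := inord ((c %% r.+1 + (r.+1 - a %% r.+1)) %% r.+1).
have am := ltn_pmod a (ltn0Sn r).
have j0E : a + j0 = c %[mod r.+1].
  rewrite inordK ?ltn_pmod // modnDmr.
  have -> : (a + (c %% r.+1 + (r.+1 - a %% r.+1)) =
             (a %/ r.+1).+1 * r.+1 + c %% r.+1)%N.
    by rewrite {1}(divn_eq a r.+1) mulSn; lia.
  by rewrite modnMDl modn_mod.
rewrite (bigD1 j0) //= j0E eqxx big1 // => j jj0.
case: eqP => // E; case/eqP: jj0; apply/val_inj.
move/eqP: E; rewrite -j0E eqn_modDl !modn_small ?ltn_ord // => /eqP.
exact.
Qed.

Lemma sum_mod_mul (r g c : nat) : (0 < r)%N ->
  (\sum_(j < g * r) (j == c %[mod r]) = g)%N.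
Proof.
move=> r0; elim: g => [|g IH]; first by rewrite big_ord0.
rewrite mulSnr big_split_ord /= IH; under eq_bigr do [].
by rewrite sum_mod_block // addn1.
Qed.

Lemma sum_mod_le (r h c : nat) : (0 < r)%N ->
  (\sum_(j < h) (j == c %[mod r]) <= h %/ r + 1)%N.
Proof.
move=> r0; rewrite addn1 -(@sum_mod_mul r (h %/ r).+1 c r0).
rewrite -!(big_mkord xpredT (fun j => nat_of_bool (j == c %[mod r]))).
rewrite [leqRHS](@big_cat_nat _ _ _ h) ?leq_addr //=.
by rewrite ltnW // -ltn_divLR.
Qed.

Lemma sum_dvd_mul (r g : nat) : (0 < r)%N ->
  (\sum_(j < g * r) (r %| j) = g)%N.
Proof.
move=> r0; rewrite -[RHS](@sum_mod_mul r g 0 r0); apply: eq_bigr => j _.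
by rewrite mod0n.
Qed.

Lemma sum_dvd (d m : nat) : (0 < d)%N -> (d %| m)%N ->
  (\sum_(j < m) (d %| j) = m %/ d)%N.
Proof. by move=> d0 /dvdnP[g ->]; rewrite sum_dvd_mul // mulnK. Qed.

Section InitialSegments.
Variable n : nat.
Local Notation b := (n.+2).
Local Notation Zb := 'Z_b.

Lemma Zb_mul_eq0 (m x : Zb) : (m * x == 0) = (b %/ gcdn m b %| x)%N.
Proof.
have g0 : (0 < gcdn m b)%N by rewrite gcdn_gt0 orbT.
have -> : (m * x == 0) = (b %| m * x)%N.
  by rewrite -[m in LHS]natr_Zp -[x in LHS]natr_Zp -natrM -[0]/(0%:R) Zb_natr_eq mod0n.
have Eb : b = (b %/ gcdn m b * gcdn m b)%N by rewrite divnK ?dvdn_gcdr.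
have Em : (m : nat) = (m %/ gcdn m b * gcdn m b)%N by rewrite divnK ?dvdn_gcdl.
rewrite [in LHS]Em [X in (X %| _)%N]Eb mulnAC dvdn_pmul2r // Gauss_dvdr //.
by rewrite /coprime gcdnC -(eqn_pmul2r g0) muln_gcdl mul1n -Eb -Em eqxx.
Qed.

Lemma ann_Zb (m : Zb) : ann m = gcdn m b.
Proof.
have g0 : (0 < gcdn m b)%N by rewrite gcdn_gt0 orbT.
have Eb : b = (gcdn m b * (b %/ gcdn m b))%N by rewrite mulnC divnK ?dvdn_gcdr.
rewrite /ann; under eq_bigr => x _ do rewrite Zb_mul_eq0.
have r0 : (0 < b %/ gcdn m b)%N by rewrite divn_gt0 // dvdn_leq // dvdn_gcdr.
have rb : (b %/ gcdn m b %| b)%N by rewrite [X in (_ %| X)%N]Eb dvdn_mull.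
by rewrite sum_dvd //; apply/eqP; rewrite eq_sym eqn_div // -Eb.
Qed.

(** gcd(a, b) is at most the sum of the common divisors of a and b, and each d dividing b has b / d
    multiples modulo b, which contribute d (b / d) = b. *)
Lemma ann_total_Zb : (ann_total Zb <= b * tau b)%N.
Proof.
rewrite /ann_total /tau big_distrr /=.
apply: (@leq_trans (\sum_(a : Zb) \sum_(d < b.+1) (d %| b) * (d * (d %| a)))%N).
  apply: leq_sum => a _; rewrite ann_Zb.
  have gb : (gcdn a b < b.+1)%N by rewrite ltnS dvdn_leq // dvdn_gcdr.
  rewrite (bigD1 (Ordinal gb)) //= dvdn_gcdr dvdn_gcdl mul1n muln1.
  exact: leq_addr.
rewrite exchange_big; apply: leq_sum => d _ /=; rewrite -big_distrr /= mulnC.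
case: (boolP (d %| b)%N) => [db|]; last by rewrite !muln0.
rewrite !muln1 -big_distrr /=.
have d0 : (0 < d)%N by apply: dvdn_gt0 db.
by rewrite sum_dvd // mulnC divnK.
Qed.

Definition initial (h : nat) : {set Zb} := [set x : Zb | (x < h)%N].

Lemma sum_initial (h : nat) (F : nat -> nat) : (h <= b)%N ->
  (\sum_(i in initial h) F i = \sum_(i < h) F i)%N.
Proof.
move=> hb.
rewrite -(big_mkord xpredT F) (big_nat_widen _ _ b) // big_mkord.
by apply: eq_bigl => i; rewrite inE.
Qed.

Lemma card_initial (h : nat) : (h <= b)%N -> #|initial h| = h.
Proof.
move=> hb; rewrite -sum1_card (sum_initial (fun=> 1%N) hb) sum_nat_const.
by rewrite card_ord muln1.
Qed.

(** Let g = gcd(m, b) and r = b / g. Then m (i - j) = 0 means i = j modulo r, which for each i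
    leaves at most h / r + 1 values of j; multiplied by b h this is at most b h + g h^2. *)
Lemma initial_spread (h : nat) (m : Zb) : (h <= b)%N ->
  (#|Zb| * (\sum_(i in initial h) \sum_(j in initial h) (m * (i - j) == 0)%R)
    <= #|Zb| * #|initial h| + ann m * #|initial h| ^ 2)%N.
Proof.
move=> hb; rewrite card_initial // card_Zb ann_Zb.
set g := gcdn m b; pose r := (b %/ g)%N.
have g0 : (0 < g)%N by rewrite gcdn_gt0 orbT.
have Eb : b = (g * r)%N by rewrite mulnC divnK ?dvdn_gcdr.
have r0 : (0 < r)%N by rewrite divn_gt0 // dvdn_leq // dvdn_gcdr.
have rb : (r %| b)%N by rewrite Eb dvdn_mull.
apply: (@leq_trans (b * (\sum_(i in initial h) (h %/ r + 1)))%N).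
  rewrite leq_mul2l; apply/orP; right; apply: leq_sum => i _.
  apply: leq_trans (sum_mod_le h i r0).
  rewrite -(sum_initial (fun j => nat_of_bool (j == i %[mod r])) hb).
  apply: leq_sum => j _; rewrite Zb_mul_eq0 -/g -/r.
  case: (boolP (r %| _)%N) => // rd.
  have /(congr1 val) /= : (i - j) + j = i by rewrite subrK.
  move=> Ei; rewrite -{1}Ei modn_dvdm // -modnDml (eqP rd) add0n.
  by rewrite eqxx.
rewrite sum_nat_const card_initial // mulnDr mulnDr addnC muln1 leq_add2l.
have L := leq_divM h r.
have -> : (b * (h * (h %/ r)) = g * h * (h %/ r * r))%N by rewrite {1}Eb; nia.
by rewrite -mulnn [leqRHS]mulnA leq_mul2l L orbT.
Qed.
End InitialSegments.

Lemma sum_eq_le1 (m c : nat) : (\sum_(j < m) (j == c :> nat) <= 1)%N.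
Proof.
have [cm|mc] := ltnP c m.
  rewrite (bigD1 (Ordinal cm)) //= eqxx big1 // => j jc.
  by rewrite (_ : (_ == _) = false) //; apply: negbTE; apply: contraNneq jc => E; apply/eqP/val_inj.
by rewrite big1 // => j _; case: eqP => // E; have := ltn_ord j; rewrite E ltnNge mc.
Qed.

Section Tents.
Variables n h k : nat.
Local Notation b := (n.+2).
Local Notation Zb := 'Z_b.
Hypothesis hk : (k.+1 * h <= b)%N.

(* [tent j] is h times a tent function of width 2 h centered at (j + 1) h; these
   tents are a partition of unity up to the factor h. *)
Definition tent (j : nat) (x : Zb) : nat :=
  diff_count (initial n h) (x - (j.+1 * h)%:R).

Lemma tent_point (j : nat) (x i i' : Zb) : (i - i' == x - (j.+1 * h)%:R) =
  (x + i' == j.+1 * h + i %[mod b])%N.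
Proof.
rewrite -Zb_natr_eq !natrD !natr_Zp.
by rewrite subr_eq addrAC eq_sym subr_eq (addrC i).
Qed.

(** The bound (j + 2) h <= (k + 1) h <= b rules out wrapping around modulo b. The upper end of the
    support is the one that matters, the trace condition being monotone in d and y. *)
Lemma tent_support (j : nat) (x : Zb) : (j < k)%N -> tent j x != 0%N ->
  (x < j.+2 * h)%N.
Proof.
move=> jk; rewrite /tent /diff_count sum_nat_eq0 negb_forall_in.
case/exists_inP => i; rewrite inE => ih.
rewrite sum_nat_eq0 negb_forall_in; case/exists_inP => i'; rewrite inE => ih'.
rewrite tent_point eqb0 negbK => /eqP E.
have xb : (x < b)%N := ltn_ord x.
have jh : (j.+2 * h <= b)%N by apply: leq_trans hk; rewrite leq_mul2r !ltnS jk orbT.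
have {}E : ((x + i') %% b = j.+1 * h + i)%N.
  by rewrite E modn_small //; rewrite mulSn in jh; lia.
have [lt|ge] := ltnP (x + i') b; first by rewrite modn_small // in E; rewrite mulSn; lia.
have : (x + i' - b = j.+1 * h + i)%N.
  by rewrite -E -[in RHS](subnK ge) modnDr modn_small //; rewrite !mulSn in jh; lia.
by rewrite mulSn; lia.
Qed.

(** Once i' is fixed, c = (x + i') mod b must equal (j + 1) h + i with i < h; Euclidean division by
    h determines i and j, so each of the h values of i' counts at most once. *)
Lemma tent_sum (x : Zb) : (\sum_(j < k) tent j x <= h)%N.
Proof.
have hb : (h <= b)%N by apply: leq_trans hk; rewrite leq_pmull.
rewrite /tent /diff_count.
under eq_bigr => j _ do rewrite exchange_big.
rewrite exchange_big /= -[leqRHS](card_initial hb) -sum1_card.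
apply: leq_sum => i' _; pose c := ((x + i') %% b)%N.
apply: (@leq_trans (\sum_(j < k) (j == (c %/ h).-1 :> nat))%N); last exact: sum_eq_le1.
apply: leq_sum => j _.
apply: (@leq_trans (\sum_(i in initial n h) (i == (c %% h)%N :> nat) * (j == (c %/ h).-1 :> nat)))%N.
  apply: leq_sum => i; rewrite inE => ih; rewrite tent_point -/c.
  have jh : (j.+2 * h <= b)%N by apply: leq_trans hk; rewrite leq_mul2r ltnS (ltn_ord j) orbT.
  rewrite modn_small; last by rewrite mulSn in jh; lia.
  case: eqP => // ->; rewrite modnMDl divnMDl; last by lia.
  by rewrite divn_small // modn_small // addn0 !eqxx.
rewrite -big_distrl /= -[leqRHS]mul1n leq_mul2r; apply/orP; right.
rewrite (sum_initial (fun i => nat_of_bool (i == c %% h)%N) hb).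
exact: sum_eq_le1.
Qed.

Definition inverse_pairs (Q : nat) : nat :=
  (\sum_(x : Zb | x \is a GRing.unit) (x + x^-1%R + b <= Q))%N.

Definition good_boxes (Q : nat) : nat :=
  (\sum_(i < k) \sum_(j < k) (i.+2 * h + j.+2 * h + b <= Q))%N.

(** If the upper right corner of the support of a product of tents satisfies the trace bound, so
    does every point in the support. At each point of the hyperbola the products of tents sum to at
    most h in each coordinate, hence h^2 in all. *)
Lemma inv_count_boxes (Q : nat) :
  (\sum_(i < k) \sum_(j < k) (i.+2 * h + j.+2 * h + b <= Q) *
     inv_count (initial n h) (i.+1 * h)%:R (j.+1 * h)%:R
   <= h ^ 2 * inverse_pairs Q)%N.
Proof.
rewrite /inv_count /inverse_pairs big_distrr /=.
under eq_bigr => i _ do (under eq_bigr => j _ do rewrite big_distrr; rewrite exchange_big).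
rewrite exchange_big /=; apply: leq_sum => x Ux.
apply: (@leq_trans (\sum_(i < k) \sum_(j < k)
   (x + x^-1%R + b <= Q) * (tent i x * tent j x^-1%R))%N).
  apply: leq_sum => i _; apply: leq_sum => j _; rewrite -/(tent i x) -/(tent j x^-1).
  have [->|/(tent_support (ltn_ord i)) si] := eqVneq (tent i x) 0%N; first by rewrite mul0n !muln0.
  have [->|/(tent_support (ltn_ord j)) sj] := eqVneq (tent j x^-1) 0%N; first by rewrite !muln0.
  rewrite leq_mul2r; apply/orP; right.
  case: (leqP _ Q) => // le; rewrite [X in (_ <= nat_of_bool X)%N](_ : _ = true) //.
  lia.
under eq_bigr => i _ do rewrite -big_distrr -big_distrr.
rewrite -big_distrr -big_distrl /= mulnC leq_mul2r; apply/orP; right.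
by rewrite -mulnn leq_mul ?tent_sum.
Qed.

(** [inv_count_lower] is uniform in the center, so it can be summed over the good boxes and compared
    with [inv_count_boxes]. *)
Lemma inverse_pairs_lower (q Q : nat) :
  (good_boxes Q * (q * h ^ 4 * totient b ^ 2) <=
   q * b ^ 2 * totient b * (h ^ 2 * inverse_pairs Q) +
   good_boxes Q * (b ^ 3 * h ^ 2 * totient b + 2 * (b * tau b) ^ 2 * h ^ 3 * q ^ 4))%N.
Proof.
have hb : (h <= b)%N by apply: leq_trans hk; rewrite leq_pmull.
have [e [eD eN eS]] := Zb_char n.
have low u v := @inv_count_lower _ e eD eN eS (initial n h)
   (fun m _ => initial_spread m hb) q u v.
have := leq_mul (leqnn (q * b ^ 2 * totient b)) (inv_count_boxes Q).
move=> box; apply: leq_trans (leq_add box (leqnn _)).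
rewrite /good_boxes !big_distrl big_distrr -big_split /=; apply: leq_sum => i _.
rewrite !big_distrl big_distrr -big_split /=; apply: leq_sum => j _.
case: (_ <= Q)%N; last by rewrite !mul0n.
rewrite !mul1n.
have := low (i.+1 * h)%:R (j.+1 * h)%:R; rewrite card_Zb nunits_Zb card_initial // addnA.
move=> /(_ isT (@Zb_two n)) L; apply: leq_trans L _.
rewrite [X in (X + _ + _ <= _)%N]mulnAC leq_add2l.
do 2 (apply: leq_mul; last exact: leqnn).
apply: leq_mul; first exact: leqnn.
by rewrite leq_sqr ann_total_Zb.
Qed.
End Tents.

Local Open Scope classical_set_scope.
Local Open Scope ring_scope.

(** * Totient sums *)

Definition totient_sum (n : nat) : nat := (\sum_(1 <= b < n.+1) totient b)%N.

Lemma sum_totient_div (n : nat) : (0 < n)%N ->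
  (\sum_(1 <= d < n.+1) (d %| n) * totient (n %/ d) = n)%N.
Proof.
move=> n0; rewrite -[RHS]sum_totient_dvd.
rewrite -(big_mkord (fun d => d %| n)%N totient) [RHS]big_mkcond /=.
rewrite [RHS]big_ltn // [X in (_ = X + _)%N](_ : _ = 0)%N; last first.
  by rewrite dvd0n; case: (n) n0.
rewrite add0n.
transitivity (\sum_(1 <= d < n.+1) \sum_(1 <= k < n.+1) (k * d == n) * totient k)%N.
  apply: eq_big_nat => d /andP[d0 dn].
  have [dvd|ndvd] := boolP (d %| n)%N; last first.
    rewrite mul0n big1 // => k _; case: eqP => // E.
    by rewrite -E dvdn_mull in ndvd.
  have q0 : (0 < n %/ d)%N by rewrite divn_gt0 // dvdn_leq.
  have qn : (n %/ d < n.+1)%N by rewrite ltnS leq_div.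
  rewrite (bigD1_seq (n %/ d)%N) ?iota_uniq ?mem_index_iota ?q0 //=.
  rewrite divnK // eqxx big1 ?addn0 // => k kn.
  by case: eqP => // E; rewrite -E mulnK // eqxx in kn.
rewrite exchange_big_nat /=; apply: eq_big_nat => k /andP[k0 kn].
have [dvd|ndvd] := boolP (k %| n)%N; last first.
  rewrite big1 // => d _; case: eqP => // E.
  by rewrite -E dvdn_mulr in ndvd.
have q0 : (0 < n %/ k)%N by rewrite divn_gt0 // dvdn_leq.
have qn : (n %/ k < n.+1)%N by rewrite ltnS leq_div.
rewrite (bigD1_seq (n %/ k)%N) ?iota_uniq ?mem_index_iota ?q0 //=.
rewrite (mulnC k) divnK // eqxx mul1n big1 ?addn0 // => d dn.
by case: eqP => // E; rewrite -E mulKn // eqxx in dn.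
Qed.

(** Passing from n to n + 1 changes the quotient by d exactly when d divides n + 1, and the
    increments add up to n + 1 by [sum_totient_div]. This exact identity is what determines the
    asymptotics of [totient_sum]. *)
Lemma sum_totient_sum (n : nat) :
  (\sum_(1 <= d < n.+1) totient_sum (n %/ d) = \sum_(1 <= m < n.+1) m)%N.
Proof.
elim: n => [|n IH]; first by rewrite !big_geq.
rewrite [RHS]big_nat_recr //= -IH -[X in (_ = _ + X)%N](@sum_totient_div n.+1) //.
rewrite [X in (_ = X + _)%N](_ : _ = \sum_(1 <= d < n.+2) totient_sum (n %/ d))%N; last first.
  by rewrite [RHS]big_nat_recr //= divn_small // [totient_sum 0]big_geq // addn0.
rewrite -big_split /=; apply: eq_big_nat => d /andP[d0 _].
rewrite divnS //; case: (_ %| _)%N; last by rewrite mul0n addn0.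
by rewrite mul1n add1n {1}/totient_sum big_nat_recr.
Qed.

Lemma double_sum_nat (n : nat) : (2 * (\sum_(1 <= m < n.+1) m) = n * n.+1)%N.
Proof.
elim: n => [|n IH]; first by rewrite big_geq.
by rewrite big_nat_recr //= mulnDr IH; lia.
Qed.

Lemma totient_le (n : nat) : (totient n <= n)%N.
Proof.
case: n => [//|n]; rewrite -{2}[n.+1]sum_totient_div // big_ltn // dvd1n divn1.
by rewrite mul1n leq_addr.
Qed.

Section Zeta.
Variable R : realType.

Definition harmonic_sum (n : nat) : R := \sum_(1 <= d < n.+1) d%:R^-1.
Definition inv_sq_sum (n : nat) : R := \sum_(1 <= d < n.+1) (d%:R ^+ 2)^-1.

(** Terms with d > 1 / eps are at most eps; the boundedly many others are at most 1 each. *)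
Lemma harmonic_sum_le (eps : R) : 0 < eps ->
  exists2 C : R, 0 <= C & forall n, harmonic_sum n <= eps * n%:R + C.
Proof.
move=> e0; pose D := (Num.truncn eps^-1).+1.
have D0 : 0 < D%:R :> R by rewrite ltr0n.
have De : D%:R^-1 <= eps.
  by rewrite invf_ple ?posrE // ltW // truncnS_gt.
exists D%:R => // n.
have : harmonic_sum n <= (minn n D)%:R + eps * n%:R.
  rewrite /harmonic_sum; elim: n => [|n IH]; first by rewrite big_geq // min0n mulr0 addr0.
  rewrite big_nat_recr //=; have [nD|Dn] := ltnP n D.
    have -> : minn n.+1 D = (minn n D).+1 by lia.
    apply: le_trans (lerD IH (lexx _)) _; rewrite -!natr1.
    have : n.+1%:R^-1 <= 1 :> R by rewrite invf_le1 ?ltr0n // ler1n.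
    by rewrite -natr1; nra.
  have -> : minn n.+1 D = minn n D by lia.
  apply: le_trans (lerD IH (lexx _)) _.
  have : n.+1%:R^-1 <= D%:R^-1 :> R by rewrite lef_pV2 ?posrE ?ltr0n // ler_nat ltnW.
  by rewrite -natr1; nra.
have : (minn n D)%:R <= D%:R :> R by rewrite ler_nat geq_minr.
lra.
Qed.

(** Since 1 / (n + 1)^2 <= 1 / n - 1 / (n + 1), the sum plus 1 / n is nonincreasing in n. *)
Lemma inv_sq_sum_tail (m n : nat) : (0 < m)%N -> (m <= n)%N ->
  inv_sq_sum n + n%:R^-1 <= inv_sq_sum m + m%:R^-1.
Proof.
move=> m0; elim: n => [|n IH]; first by lia.
rewrite leq_eqVlt => /orP[/eqP <- //|]; rewrite ltnS => mn.
apply: le_trans (IH mn); rewrite {1}/inv_sq_sum big_nat_recr //= -/(inv_sq_sum n).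
rewrite -addrA lerD2l.
have n0 : 0 < n%:R :> R by rewrite ltr0n; lia.
have -> : n.+1%:R = n%:R + 1 :> R by rewrite natr1.
rewrite -subr_ge0.
have -> : n%:R^-1 - ((n%:R + 1) ^- 2 + (n%:R + 1)^-1) = ((n%:R + 1) ^- 2) / n%:R :> R.
  by field; rewrite !gt_eqF //; lra.
by rewrite mulr_ge0 ?invr_ge0 ?exprn_ge0 //; lra.
Qed.

Lemma zeta2_series : [series (n.+1%:R `^ (2 : R))^-1]_n = inv_sq_sum.
Proof.
apply/funext => n; rewrite /series /= /inv_sq_sum big_add1 /=.
by apply: eq_bigr => i _; rewrite -powR_mulrn ?ler0n.
Qed.

Lemma zeta2_cvg : inv_sq_sum n @[n --> \oo] --> zeta (2 : R).
Proof.
rewrite -zeta2_series; apply: nondecreasing_is_cvgn.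
  by apply: nondecreasing_series => n _ _; rewrite invr_ge0 powR_ge0.
exists (1 + 1); rewrite zeta2_series => _ [n _ <-].
have n1 : inv_sq_sum n <= inv_sq_sum n.+1.
  by rewrite [leRHS]/inv_sq_sum big_nat_recr //= lerDl invr_ge0 exprn_ge0.
apply: (le_trans n1); have := @inv_sq_sum_tail 1 n.+1 isT isT.
rewrite [inv_sq_sum 1]big_nat1 expr1n !invr1.
have : 0 <= n.+1%:R^-1 :> R by rewrite invr_ge0.
by move=> a b; apply: le_trans b; rewrite lerDl.
Qed.

Lemma inv_sq_sum_le_zeta (n : nat) : inv_sq_sum n <= zeta (2 : R).
Proof.
rewrite -(cvg_lim _ zeta2_cvg) //; apply: nondecreasing_cvgn_le.
  rewrite -zeta2_series; apply: nondecreasing_series => k _ _.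
  by rewrite invr_ge0 powR_ge0.
by apply/cvg_ex; eexists; exact: zeta2_cvg.
Qed.

Lemma zeta_le_inv_sq_sum (m : nat) : (0 < m)%N ->
  zeta (2 : R) <= inv_sq_sum m + m%:R^-1.
Proof.
move=> m0; rewrite -(cvg_lim _ zeta2_cvg) //; apply: limr_le.
  by apply/cvg_ex; eexists; exact: zeta2_cvg.
exists m => // n /= mn; apply: le_trans (inv_sq_sum_tail m0 mn).
by rewrite lerDl invr_ge0.
Qed.

Lemma zeta2_ge1 : 1 <= zeta (2 : R).
Proof.
apply: le_trans (inv_sq_sum_le_zeta 1).
by rewrite /inv_sq_sum big_nat1 expr1n invr1.
Qed.

(** The bound is 1 + 1/4 + 1/2, stopping at m = 2. Stopping at m = 1 would give 2, and zeta(2) - 1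
    would no longer be seen to be a contraction factor. *)
Lemma zeta2_le : zeta (2 : R) <= 7 / 4.
Proof.
apply: le_trans (@zeta_le_inv_sq_sum 2 isT) _.
rewrite /inv_sq_sum big_nat_recr //= big_nat1; lra.
Qed.

Local Notation c := ((2 * zeta (2 : R))^-1).

Lemma half_inv_zeta2_bounds : 0 < c <= 2^-1.
Proof.
have z1 := zeta2_ge1; apply/andP; split; first by rewrite invr_gt0; lra.
by rewrite lef_pV2 ?posrE; lra.
Qed.

Definition totient_err (n : nat) : R := (totient_sum n)%:R - c * n%:R ^+ 2.

Lemma natdiv_le (n d : nat) : (n %/ d)%:R <= n%:R / d%:R :> R.
Proof.
case: d => [|d]; first by rewrite divn0 invr0 mulr0.
by rewrite ler_pdivlMr ?ltr0n // -natrM ler_nat leq_divM.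
Qed.

Lemma natdiv_gt (n d : nat) : (0 < d)%N -> n%:R / d%:R - 1 < (n %/ d)%:R :> R.
Proof.
move=> d0; rewrite ltrBlDr ltr_pdivrMr ?ltr0n // natr1 -natrM ltr_nat.
exact: ltn_ceil.
Qed.

Lemma natdiv_sq_ge (n d : nat) : (0 < d)%N ->
  (n%:R / d%:R) ^+ 2 - 2 * (n%:R / d%:R) <= (n %/ d)%:R ^+ 2 :> R.
Proof.
move=> d0; have := natdiv_gt n d0; have : 0 <= n%:R / d%:R :> R by rewrite divr_ge0.
have : 0 <= (n %/ d)%:R :> R by []. 
move: (n%:R / d%:R) (n %/ d)%:R => x y y0 x0 xy.
have [x1|x1] := leP 1 x; nra.
Qed.

(** [sum_totient_sum] evaluates the totient part as n (n + 1) / 2, and the quadratic part is c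
    zeta(2) n^2 = n^2 / 2 up to rounding, so the main terms cancel. *)
Lemma sum_totient_err_le (n : nat) :
  `|\sum_(1 <= d < n.+1) totient_err (n %/ d)| <= 2 * n%:R + n%:R * harmonic_sum n.
Proof.
have [c0 c1] := andP half_inv_zeta2_bounds; have z1 := zeta2_ge1.
have cz : c * zeta (2 : R) = 2^-1 by field; rewrite gt_eqF //; lra.
case: n => [|n]; first by rewrite big_geq // normr0 mulr0 mul0r addr0.
set N := n.+1; have N0 : 0 < N%:R :> R by rewrite ltr0n.
pose S : R := \sum_(1 <= d < N.+1) (N %/ d)%:R ^+ 2.
have -> : \sum_(1 <= d < N.+1) totient_err (N %/ d) =
   2^-1 * (N%:R ^+ 2 + N%:R) - c * S.
  rewrite /totient_err sumrB -natr_sum sum_totient_sum -big_distrr /=.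
  congr (_ - _); apply: (@mulfI _ 2); first by rewrite pnatr_eq0.
  rewrite mulrA divff ?pnatr_eq0 // mul1r -natrM.
  rewrite double_sum_nat natrM -natr1; ring.
have S1 : S <= N%:R ^+ 2 * zeta 2.
  apply: le_trans (ler_wpM2l _ (inv_sq_sum_le_zeta N)); last by rewrite exprn_ge0.
  rewrite /inv_sq_sum big_distrr /=; apply: ler_sum => d _.
  by rewrite -exprVn -exprMn lerXn2r ?nnegrE ?divr_ge0 // natdiv_le.
have S2 : N%:R ^+ 2 * (zeta 2 - N%:R^-1) - 2 * N%:R * harmonic_sum N <= S.
  apply: (@le_trans _ _ (N%:R ^+ 2 * inv_sq_sum N - 2 * N%:R * harmonic_sum N)).
    rewrite lerD2r; apply: ler_wpM2l; first by rewrite exprn_ge0.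
    by rewrite lerBlDr zeta_le_inv_sq_sum.
  rewrite /inv_sq_sum /harmonic_sum !big_distrr -sumrB /=.
  apply: ler_sum_nat => d /andP[d0 _].
  by have := natdiv_sq_ge N d0; rewrite exprMn exprVn !mulrA.
have H0 : 0 <= harmonic_sum N by rewrite sumr_ge0.
have S3 : S >= N%:R ^+ 2 * zeta 2 - N%:R - 2 * N%:R * harmonic_sum N.
  apply: le_trans S2; rewrite mulrBr expr2 mulfK ?gt_eqF //.
have T1 : c * S <= 2^-1 * N%:R ^+ 2.
  by rewrite -cz mulrAC -mulrA; apply: ler_wpM2l S1; exact: ltW.
have T2 : 2^-1 * N%:R ^+ 2 - c * (N%:R + 2 * N%:R * harmonic_sum N) <= c * S.
  rewrite -cz mulrAC -mulrA -mulrBr; apply: ler_wpM2l; first exact: ltW.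
  by rewrite opprD addrA.
have T3 : c * (N%:R + 2 * N%:R * harmonic_sum N) <= 2^-1 * (N%:R + 2 * N%:R * harmonic_sum N).
  by apply: ler_wpM2r c1; rewrite addr_ge0 ?mulr_ge0.
have NH : 0 <= N%:R * harmonic_sum N by rewrite mulr_ge0.
rewrite ler_norml; apply/andP; split; lra.
Qed.

Lemma totient_err_trivial (n : nat) : `|totient_err n| <= 2 * n%:R ^+ 2.
Proof.
have [c0 c1] := andP half_inv_zeta2_bounds.
have : (totient_sum n)%:R <= n%:R ^+ 2 :> R.
  rewrite -natrX ler_nat /totient_sum -mulnn.
  rewrite -{2}[n]card_ord -sum_nat_const big_add1 big_mkord.
  by apply: leq_sum => i _; exact: leq_trans (totient_le _) (ltn_ord i).
have : 0 <= (totient_sum n)%:R :> R by [].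
have : 0 <= n%:R ^+ 2 :> R by rewrite exprn_ge0.
rewrite /totient_err ler_norml.
move: (n%:R ^+ 2) (totient_sum n)%:R c c0 c1 => x y k k0 k1 x0 y0 xy.
apply/andP; split; nra.
Qed.

(* Isolating the term d = 1 of [sum_totient_err_le] contracts the error by
   zeta(2) - 1 <= 3/4; the margin up to 7/8 absorbs the lower-order terms. *)
Lemma totient_err_step (eta : R) : 0 < eta ->
  (exists2 C : R, 0 <= C & forall n, `|totient_err n| <= eta * n%:R ^+ 2 + C * n%:R) ->
  exists2 C : R, 0 <= C &
    forall n, `|totient_err n| <= (7 / 8 * eta) * n%:R ^+ 2 + C * n%:R.
Proof.
move=> eta0 [C C0 HC].
(* The product n [harmonic_sum n] arrives with coefficient C from the terms d >= 2 and 1 from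
   [sum_totient_err_le]; this eps makes its quadratic part cost eta / 8, the gap between 3/4 and
   7/8. *)
pose eps := eta / (8 * (C + 1)).
have eps0 : 0 < eps by rewrite divr_gt0 // mulr_gt0 //; lra.
have epsE : eps * (C + 1) = eta / 8 by rewrite /eps; field; rewrite gt_eqF //; lra.
have [K K0 HK] := harmonic_sum_le eps0.
exists (2 + (C + 1) * K); first by rewrite addr_ge0 // mulr_ge0 //; lra.
case=> [|n]; first by rewrite /totient_err /totient_sum big_geq // !expr2 !mulr0 subrr normr0 addr0.
set N := n.+1.
have N0 : 0 < N%:R :> R by rewrite ltr0n.
have err1 : totient_err N = \sum_(1 <= d < N.+1) totient_err (N %/ d) -
    \sum_(2 <= d < N.+1) totient_err (N %/ d).
  by rewrite big_ltn // divn1 addrK.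
have tail : `|\sum_(2 <= d < N.+1) totient_err (N %/ d)| <=
   eta * (N%:R ^+ 2 * (zeta 2 - 1)) + C * (N%:R * harmonic_sum N).
  apply: le_trans (ler_norm_sum _ _ _) _.
  apply: (@le_trans _ _ (\sum_(2 <= d < N.+1)
      (eta * (N%:R ^+ 2 * (d%:R ^+ 2)^-1) + C * (N%:R * d%:R^-1)))).
    apply: ler_sum_nat => d _; apply: le_trans (HC _) _; apply: lerD.
      apply: ler_wpM2l; first exact: ltW.
      by rewrite -exprVn -exprMn lerXn2r ?nnegrE ?divr_ge0 // natdiv_le.
    by apply: ler_wpM2l => //; exact: natdiv_le.
  rewrite big_split /= -!big_distrr /=; apply: lerD.
    apply: ler_wpM2l; first exact: ltW.
    apply: ler_wpM2l; first by rewrite exprn_ge0.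
    rewrite lerBrDr; apply: le_trans (inv_sq_sum_le_zeta N).
    by rewrite /inv_sq_sum [leRHS]big_ltn // expr1n invr1 addrC.
  apply: ler_wpM2l => //; apply: ler_wpM2l; first exact: ltW.
  by rewrite /harmonic_sum [leRHS]big_ltn // lerDr invr_ge0.
have := sum_totient_err_le N; have := HK N; have := zeta2_le.
have := ler_normB (\sum_(1 <= d < N.+1) totient_err (N %/ d))
    (\sum_(2 <= d < N.+1) totient_err (N %/ d)).
rewrite -err1 => h1 z1 h2 h3.
have h4 : N%:R * harmonic_sum N <= N%:R * (eps * N%:R + K) by apply: ler_wpM2l h2; exact: ltW.
have h5 : (C + 1) * (N%:R * harmonic_sum N) <= (C + 1) * (N%:R * (eps * N%:R + K)).
  by apply: ler_wpM2l h4; lra.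
have h6 : (C + 1) * (N%:R * (eps * N%:R + K)) = eta / 8 * N%:R ^+ 2 + (C + 1) * K * N%:R.
  by rewrite -epsE; ring.
have h7 : eta * (N%:R ^+ 2 * (zeta 2 - 1)) <= eta * (N%:R ^+ 2 * (3 / 4)).
  apply: ler_wpM2l; first exact: ltW.
  by apply: ler_wpM2l; rewrite ?exprn_ge0 //; lra.
rewrite mulrDl; lra.
Qed.

(** The contraction is iterated from the trivial bound until 2 (7/8)^j <= eta; the linear constant C
    may grow with j. *)
Theorem totient_sum_asymptotic (eta : R) : 0 < eta ->
  exists2 C : R, 0 <= C & forall n, `|totient_err n| <= eta * n%:R ^+ 2 + C * n%:R.
Proof.
move=> eta0.
have iter (j : nat) : exists2 C : R, 0 <= C &
    forall n, `|totient_err n| <= ((7 / 8) ^+ j * 2) * n%:R ^+ 2 + C * n%:R.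
  elim: j => [|j IH].
    by exists 0 => // n; rewrite mul0r addr0 expr0 mul1r totient_err_trivial.
  by rewrite exprS -mulrA; apply: totient_err_step IH; rewrite mulr_gt0 // exprn_gt0 //; lra.
have [j Hj] : exists j : nat, (7 / 8) ^+ j * 2 <= eta.
  have : `|7 / 8 : R| < 1 by rewrite ger0_norm; lra.
  move/cvg_expr/cvgrPdist_lt => /(_ (eta / 2)); case; first by rewrite divr_gt0.
  move=> j _ /(_ j (leqnn j)); rewrite sub0r normrN => H; exists j.
  by have := le_lt_trans (ler_norm _) H; rewrite ltr_pdivlMr // => /ltW.
have [C C0 HC] := iter j; exists C => // n; apply: le_trans (HC n) _.
by rewrite lerD2r; apply: ler_wpM2r Hj; rewrite exprn_ge0.
Qed.
End Zeta.

(** * The density constant *)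

Section BoxSum.
Variable R : realType.

(* Lower Riemann sum of 1 / (1 + u + v)^2 over the unit square, with u and v
   taken at the right ends (i + 2) / (k + 1) and (j + 2) / (k + 1) of the supports
   of the tents. *)
Definition box_sum (k : nat) : R :=
  \sum_(i < k) \sum_(j < k) ((k.+1 + i + j + 4)%N%:R ^+ 2)^-1.

Lemma ln_diff_le (x y : R) : 0 < x -> 0 < y -> ln y - ln x <= (y - x) / x.
Proof.
move=> x0 y0; rewrite -ln_div ?posrE //.
have yx : 0 < y / x by rewrite divr_gt0.
have -> : y / x = 1 + (y - x) / x by field; rewrite gt_eqF.
apply: le_ln1Dx.
have -> : (y - x) / x = y / x - 1 by field; rewrite gt_eqF.
lra.
Qed.

Lemma ln_diff_ge (x y : R) : 0 < x -> 0 < y -> (y - x) / y <= ln y - ln x.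
Proof.
move=> x0 y0; have := ln_diff_le y0 x0.
have -> : (x - y) / y = - ((y - x) / y) by rewrite -mulNr opprB.
lra.
Qed.

Lemma sum_inv_ge (a k : nat) : (0 < a)%N ->
  ln (a + k)%N%:R - ln a%:R <= \sum_(i < k) (a + i)%N%:R^-1 :> R.
Proof.
move=> a0; elim: k => [|k IH]; first by rewrite big_ord0 addn0 subrr.
rewrite big_ord_recr /= addnS.
have p : 0 < (a + k)%N%:R :> R by rewrite ltr0n; lia.
have p' : 0 < (a + k).+1%:R :> R by rewrite ltr0n.
have := ln_diff_le p p'; rewrite -natr1 addrAC subrr add0r div1r; lra.
Qed.

Lemma sum_inv_le (a k : nat) : (0 < a)%N ->
  \sum_(i < k) (a + i).+1%:R^-1 <= ln (a + k)%N%:R - ln a%:R :> R.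
Proof.
move=> a0; elim: k => [|k IH]; first by rewrite big_ord0 addn0 subrr.
rewrite big_ord_recr /= addnS.
have p : 0 < (a + k)%N%:R :> R by rewrite ltr0n; lia.
have p' : 0 < (a + k).+1%:R :> R by rewrite ltr0n.
have := ln_diff_ge p p'.
rewrite -{1}natr1 (addrAC _ 1) subrr add0r div1r => h.
by apply: le_trans (lerD IH h) _; rewrite addrC subrKA.
Qed.

Lemma sum_inv_sq_ge (a k : nat) : (0 < a)%N ->
  a%:R^-1 - (a + k)%N%:R^-1 <= \sum_(j < k) ((a + j)%N%:R ^+ 2)^-1 :> R.
Proof.
move=> a0; elim: k => [|k IH]; first by rewrite big_ord0 addn0 subrr.
rewrite big_ord_recr /= addnS.
suff h : (a + k)%N%:R^-1 - (a + k).+1%:R^-1 <= ((a + k)%N%:R ^+ 2)^-1 :> R.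
  by have := lerD IH h; rewrite subrKA.
have p : 0 < (a + k)%N%:R :> R by rewrite ltr0n; lia.
rewrite -natr1; move: (a + k)%N%:R p => x x0; rewrite -subr_ge0.
have -> : (x ^+ 2)^-1 - (x^-1 - (x + 1)^-1) = (x ^+ 2)^-1 / (x + 1).
  by field; rewrite !gt_eqF //; lra.
by rewrite mulr_ge0 ?invr_ge0 ?exprn_ge0 //; lra.
Qed.

(** The inner sum telescopes to 1 / (k + 5 + i) - 1 / (2 k + 5 + i). Comparing the sums over i with
    logarithms gives about ln 2 - ln (3/2) = ln (4/3). *)
Lemma box_sum_ge (k : nat) : ln (4 / 3) - 5 / (2 * k + 5)%N%:R <= box_sum k.
Proof.
have step : ln (k + 5 + k)%N%:R - ln (k + 5)%N%:R
   - (ln (2 * k + 4 + k)%N%:R - ln (2 * k + 4)%N%:R) <= box_sum k.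
  apply: (@le_trans _ _ (\sum_(i < k) ((k + 5 + i)%N%:R^-1 - (2 * k + 4 + i).+1%:R^-1))).
    by rewrite sumrB; apply: lerB; [apply: sum_inv_ge | apply: sum_inv_le]; lia.
  apply: ler_sum => i _; have := @sum_inv_sq_ge (k + 5 + i) k.
  rewrite (_ : k + 5 + i + k = (2 * k + 4 + i).+1)%N; last by lia.
  move=> H; apply: le_trans (H _) _; first by lia.
  apply: ler_sum => j _; rewrite (_ : k + 5 + i + j = k.+1 + i + j + 4)%N //; lia.
apply: le_trans step.
have pos m : 0 < m.+1%:R :> R by rewrite ltr0n.
have E1 : (k + 5 + k)%N = (2 * k + 4).+1 by lia.
(* Replacing 2 k + 5 by 2 (k + 5) is the one change that loses, and gives the error term; the change
   from 3 k + 4 to 3 (k + 2) goes the right way. *)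
have D1 : - (5 / (2 * k + 5)%N%:R) <= ln (k + 5 + k)%N%:R - ln (2 * (k + 5))%N%:R :> R.
  have := @ln_diff_ge (2 * (k + 5))%N%:R (2 * k + 5)%N%:R.
  rewrite !ltr0n => /(_ ltac:(lia) ltac:(lia)).
  have -> : (k + 5 + k = 2 * k + 5)%N by lia.
  apply: le_trans; rewrite -mulNr; rewrite le_eqVlt; apply/orP; left; apply/eqP; congr (_ / _).
  by rewrite !natrM !natrD; ring.
have D2 : ln (2 * k + 4 + k)%N%:R <= ln (3 * (k + 2))%N%:R :> R.
  by rewrite ler_ln ?posrE ?ltr0n ?ler_nat; lia.
have D3 : ln (2 * (k + 5))%N%:R = ln 2 + ln (k + 5)%N%:R :> R.
  by rewrite natrM lnM ?posrE ?ltr0n //; lia.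
have D4 : ln (3 * (k + 2))%N%:R = ln 3 + ln (k + 2)%N%:R :> R.
  by rewrite natrM lnM ?posrE ?ltr0n //; lia.
have D5 : ln (2 * k + 4)%N%:R = ln 2 + ln (k + 2)%N%:R :> R.
  rewrite (_ : 2 * k + 4 = 2 * (k + 2))%N; last by lia.
  by rewrite natrM lnM ?posrE ?ltr0n //; lia.
have D6 : ln (4 / 3) = ln 2 + ln 2 - ln 3 :> R.
  rewrite ln_div ?posrE // -lnM ?posrE //; congr (ln _ - _); lra.
lra.
Qed.

Lemma box_sum_lower (eps : R) : 0 < eps -> exists k, ln (4 / 3) - eps <= box_sum k.
Proof.
move=> e0; exists (Num.truncn (5 / eps)).+1; apply: le_trans (box_sum_ge _).
rewrite lerD2l lerN2 ler_pdivrMr ?ltr0n; last by lia.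
rewrite mulrC -ler_pdivrMr //; apply: le_trans (ltW (truncnS_gt _)) _.
by rewrite ler_nat; move: (Num.truncn _) => m; lia.
Qed.
End BoxSum.

(** * Counting inverse pairs *)

(** Good boxes for the exact mesh b / (k + 1) instead of its integer part; the condition becomes an
    upper bound on b alone, so that summing over b yields totient sums. *)
Definition box_count (k b Q : nat) : nat :=
  (\sum_(i < k) \sum_(j < k) (b * (k.+1 + i + j + 4) <= k.+1 * Q))%N.

Lemma box_count_le (k n Q : nat) :
  (box_count k n.+2 Q <= good_boxes n (n.+2 %/ k.+1) k Q)%N.
Proof.
apply: leq_sum => i _; apply: leq_sum => j _.
have [H|//] := boolP (_ * _ <= _ * Q)%N; rewrite [X in (_ <= nat_of_bool X)%N](_ : _ = true) //.
rewrite -(leq_pmul2l (ltn0Sn k)); apply: leq_trans H.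
have L := leq_mul (leqnn (i + j + 4)%N) (leq_divM n.+2 k.+1).
have -> : (k.+1 * (i.+2 * (n.+2 %/ k.+1) + j.+2 * (n.+2 %/ k.+1) + n.+2) =
  (i + j + 4) * (n.+2 %/ k.+1 * k.+1) + k.+1 * n.+2)%N.
  by move: (n.+2 %/ k.+1)%N => h; nia.
have -> : (n.+2 * (k.+1 + i + j + 4) = (i + j + 4) * n.+2 + k.+1 * n.+2)%N by nia.
by rewrite leq_add2r.
Qed.

Lemma good_boxes_le (k n h Q : nat) : (good_boxes n h k Q <= k ^ 2)%N.
Proof.
have kk : (\sum_(i < k) \sum_(j < k) 1 = k ^ 2)%N.
  by rewrite -mulnn !sum_nat_const !card_ord muln1.
rewrite -kk; apply: leq_sum => i _; apply: leq_sum => j _; exact: leq_b1.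
Qed.

Section Modulus.
Variable R : realType.

(** Here G counts good boxes, K = k + 1 and h is the integer part of b / K. Since K h > b - K,
    replacing h^2 / b^2 by 1 / K^2 costs at most 2 K. The rest is the main inequality divided by q
    b^2 phi h^2. *)
Lemma inverse_pairs_real_aux (G b h phi N t q K : R) :
  0 <= G -> G <= K ^+ 2 -> 0 < h -> 1 <= b -> 0 < phi -> phi <= b -> 0 <= N ->
  0 <= t -> 1 <= q -> 1 <= K -> K * h <= b -> b < K * (h + 1) ->
  G * (q * h ^+ 4 * phi ^+ 2) <= q * b ^+ 2 * phi * (h ^+ 2 * N)
    + G * (b ^+ 3 * h ^+ 2 * phi + 2 * (b * t) ^+ 2 * h ^+ 3 * q ^+ 4) ->
  G * phi / K ^+ 2 <= N + 2 * K + K ^+ 2 * b / q + 2 * K ^+ 2 * t ^+ 2 * q ^+ 4.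
Proof.
move=> G0 GK h0 b1 phi0 phib N0 t0 q1 K1 Kh bK main.
have b0 : 0 < b by lra.
have K0 : 0 < K by lra.
have q0 : 0 < q by lra.
have [K00 q00 b00 h00 phi00] : [/\ 0 <= K, 0 <= q, 0 <= b, 0 <= h & 0 <= phi].
  by split; exact: ltW.
have hb : h <= b by nra.
have GK1 : G / K ^+ 2 <= 1 by rewrite ler_pdivrMr ?exprn_gt0 // mul1r.
have E0 : 0 <= G / K ^+ 2 by rewrite divr_ge0 // exprn_ge0.
have L : G * phi / K ^+ 2 <= G * h ^+ 2 * phi / b ^+ 2 + 2 * K.
  have hbK : 1 - K / b <= K * h / b.
    rewrite -[1](@divff _ b) ?gt_eqF // -mulrBl; apply: ler_wpM2r; last by lra.
    by rewrite invr_ge0 ltW.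
  have sq : 1 - 2 * (K / b) <= (K * h / b) ^+ 2.
    have : 0 <= K * h / b by rewrite !mulr_ge0 ?invr_ge0 ?ltW.
    have : 0 <= K / b by rewrite divr_ge0 ?ltW.
    move: hbK; move: (K / b) (K * h / b) => x y xy x0 y0.
    have [x1|x1] := leP x 1; nra.
  have E : G * h ^+ 2 * phi / b ^+ 2 = (G / K ^+ 2) * phi * (K * h / b) ^+ 2.
    by field; rewrite !gt_eqF.
  have E2 : G * phi / K ^+ 2 = (G / K ^+ 2) * phi by rewrite mulrAC.
  rewrite E E2.
  have : (G / K ^+ 2) * phi * (1 - 2 * (K / b)) <= (G / K ^+ 2) * phi * (K * h / b) ^+ 2.
    by apply: ler_wpM2l sq; rewrite mulr_ge0 // ltW.
  have : (G / K ^+ 2) * phi * (2 * (K / b)) <= 2 * K.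
    have -> : (G / K ^+ 2) * phi * (2 * (K / b)) = (G / K ^+ 2) * (phi / b) * (2 * K).
      by field; rewrite !gt_eqF.
    have pb : phi / b <= 1 by rewrite ler_pdivrMr // mul1r.
    have pb0 : 0 <= phi / b by rewrite divr_ge0 ?ltW.
    rewrite -[leRHS]mul1r; apply: ler_wpM2r; first lra.
    by rewrite -[1]mulr1; apply: ler_pM.
  lra.
suff S : G * h ^+ 2 * phi / b ^+ 2 <= N + K ^+ 2 * b / q + 2 * K ^+ 2 * t ^+ 2 * q ^+ 4 by lra.
have t2 : 0 <= 2 * K ^+ 2 * t ^+ 2 * q ^+ 4 by rewrite !mulr_ge0 ?exprn_ge0 //; lra.
(* If phi < b / q, the left side is trivially at most K^2 b / q. Otherwise h / phi <= q, which turns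
   the factor q^3 into q^4. *)
have [big|small] := leP b (q * phi); last first.
  suff : G * h ^+ 2 * phi / b ^+ 2 <= K ^+ 2 * b / q by lra.
  have -> : G * h ^+ 2 * phi / b ^+ 2 = G * ((h / b) ^+ 2 * phi).
    by field; rewrite gt_eqF.
  rewrite -mulrA; apply: ler_pM => //; first by rewrite mulr_ge0 ?exprn_ge0 ?divr_ge0 ?ltW.
  have hb1 : h / b <= 1 by rewrite ler_pdivrMr // mul1r.
  have hb2 : (h / b) ^+ 2 <= 1 by rewrite exprn_ile1 // divr_ge0 ?ltW.
  apply: le_trans (ler_wpM2r phi00 hb2) _.
  by rewrite mul1r ler_pdivlMr // mulrC ltW.
have D : G * h ^+ 2 * phi / b ^+ 2 <= N + G * (b / q + 2 * t ^+ 2 * (h / phi) * q ^+ 3).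
  rewrite -(@ler_pM2r _ (q * b ^+ 2 * phi * h ^+ 2)); last by rewrite !mulr_gt0 ?exprn_gt0.
  have -> : G * h ^+ 2 * phi / b ^+ 2 * (q * b ^+ 2 * phi * h ^+ 2) =
    G * (q * h ^+ 4 * phi ^+ 2) by field; rewrite gt_eqF.
  apply: le_trans main _; rewrite le_eqVlt; apply/orP; left; apply/eqP.
  by field; rewrite !gt_eqF.
apply: le_trans D _; rewrite -addrA lerD2l.
have -> : K ^+ 2 * b / q + 2 * K ^+ 2 * t ^+ 2 * q ^+ 4 = K ^+ 2 * (b / q + 2 * t ^+ 2 * q * q ^+ 3).
  by field; rewrite gt_eqF.
have hp : h / phi <= q by rewrite ler_pdivrMr //; lra.
have hp0 : 0 <= h / phi by rewrite divr_ge0 ?ltW.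
have q3 : 0 <= q ^+ 3 by rewrite exprn_ge0 // ltW.
have tt : 0 <= t ^+ 2 by rewrite exprn_ge0.
apply: ler_pM => //; first by rewrite addr_ge0 ?divr_ge0 // !mulr_ge0 ?invr_ge0 ?exprn_ge0.
rewrite lerD2l; apply: ler_wpM2r => //; apply: ler_wpM2l => //.
by rewrite mulr_ge0.
Qed.

Lemma inverse_pairs_real (k n q Q : nat) : (0 < q)%N ->
  (box_count k n.+2 Q)%:R * (totient n.+2)%:R / k.+1%:R ^+ 2 <=
  (inverse_pairs n Q)%:R + 2 * k.+1%:R + k.+1%:R ^+ 2 * n.+2%:R / q%:R
    + 2 * k.+1%:R ^+ 2 * (tau n.+2)%:R ^+ 2 * q%:R ^+ 4 :> R.
Proof.
move=> q0; set b := n.+2; set K := k.+1; pose h := (b %/ K)%N.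
pose G := good_boxes n h k Q.
have hK : (K * h <= b)%N by rewrite mulnC leq_divM.
have K0 : 0 < K%:R ^+ 2 :> R by rewrite exprn_gt0 // ltr0n.
have phib : (totient b)%:R <= b%:R :> R by rewrite ler_nat totient_le.
have GK : G%:R <= K%:R ^+ 2 :> R.
  rewrite -natrX ler_nat; apply: leq_trans (good_boxes_le _ _ _ _) _.
  by rewrite leq_sqr leqnSn.
have GG : (box_count k b Q)%:R <= G%:R :> R by rewrite ler_nat box_count_le.
apply: (@le_trans _ _ (G%:R * (totient b)%:R / K%:R ^+ 2)).
  by apply: ler_wpM2r; [rewrite invr_ge0 ltW | apply: ler_wpM2r].
have bK : (b < K * h.+1)%N by rewrite mulnC ltn_ceil.
(* If h = 0 then b < K, and the left side is at most totient(b) <= K. *)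
have [h0|h0] := posnP h; last first.
  apply: (@inverse_pairs_real_aux _ _ h%:R) => //; rewrite ?ltr0n ?totient_gt0 ?ler1n //.
  - by rewrite -natrM ler_nat.
  - by rewrite natr1 -natrM ltr_nat.
  have := inverse_pairs_lower hK q Q.
  by rewrite -(ler_nat R) !(natrD, natrM, natrX).
rewrite h0 muln1 in bK.
have : G%:R * (totient b)%:R / K%:R ^+ 2 <= K%:R :> R.
  rewrite mulrAC -[leRHS]mul1r; apply: ler_pM => //.
  - by rewrite ler_pdivrMr // mul1r.
  - by apply: le_trans phib _; rewrite ler_nat ltnW.
have : 0 <= (inverse_pairs n Q)%:R :> R by [].
have : 0 <= K%:R ^+ 2 * b%:R / q%:R :> R by rewrite !mulr_ge0 ?invr_ge0.
have : 0 <= 2 * K%:R ^+ 2 * (tau b)%:R ^+ 2 * q%:R ^+ 4 :> R by rewrite !mulr_ge0 ?exprn_ge0.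
have : 0 <= K%:R :> R by [].
lra.
Qed.
End Modulus.

(** [inverse_pairs n] concerns the modulus n + 2, hence the shift. *)
Definition pair_count (Q : nat) : nat :=
  (\sum_(2 <= b < Q.+1) inverse_pairs b.-2 Q)%N.

Lemma sum_box_count (k Q : nat) :
  (\sum_(1 <= b < Q.+1) box_count k b Q * totient b =
   \sum_(i < k) \sum_(j < k) totient_sum ((k.+1 * Q) %/ (k.+1 + i + j + 4)))%N.
Proof.
rewrite /box_count.
under eq_bigr => b _ do (rewrite big_distrl; under eq_bigr => i _ do rewrite big_distrl).
rewrite exchange_big; apply: eq_bigr => i _; rewrite exchange_big; apply: eq_bigr => j _ /=.
set s := (k.+1 + i + j + 4)%N; have s0 : (0 < s)%N by rewrite /s; lia.
set m := (k.+1 * Q %/ s)%N.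
have mQ : (m <= Q)%N.
  apply: (@leq_trans (k.+1 * Q %/ k.+1)%N); last by rewrite mulKn.
  by apply: leq_div2l => //; rewrite /s; lia.
rewrite /totient_sum (@big_cat_nat _ _ _ m.+1) //= [X in (_ + X)%N]big_nat.
rewrite [X in (_ + X)%N]big1 ?addn0 => [|b /andP[mb _]]; last first.
  by rewrite -leq_divRL // leqNgt mb mul0n.
rewrite big_nat [RHS]big_nat; apply: eq_bigr => b /andP[_ bm].
by rewrite -leq_divRL // -ltnS bm mul1n.
Qed.

Section PairCount.
Variable R : realType.
Local Notation c := ((2 * zeta (2 : R))^-1).

(** Each box contributes a totient sum at some m <= Q. Rounding to m loses at most 2 Q in the
    square, hence at most Q after multiplication by c <= 1/2: this is the 1 in C + 1. The k^2 errors
    are divided by (k + 1)^2. *)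
Lemma sum_box_count_lower (eta C : R) (k Q : nat) : 0 < eta -> 0 <= C ->
  (forall n, `|totient_err R n| <= eta * n%:R ^+ 2 + C * n%:R) ->
  c * Q%:R ^+ 2 * box_sum R k - eta * Q%:R ^+ 2 - (C + 1) * Q%:R <=
  (\sum_(1 <= b < Q.+1) box_count k b Q * totient b)%N%:R / k.+1%:R ^+ 2.
Proof.
move=> eta0 C0 HC; have [c0 c1] := andP (half_inv_zeta2_bounds R).
have K0 : 0 < k.+1%:R :> R by rewrite ltr0n.
set K : R := k.+1%:R in K0 *.
have K2 : 0 < K ^+ 2 by rewrite exprn_gt0.
rewrite sum_box_count natr_sum ler_pdivlMr //.
apply: (@le_trans _ _ (\sum_(i < k) \sum_(j < k)
   (c * ((K * Q%:R) ^+ 2 * ((k.+1 + i + j + 4)%N%:R ^+ 2)^-1) -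
     (eta * Q%:R ^+ 2 + (C + 1) * Q%:R)))).
  under eq_bigr => i _ do rewrite sumrB.
  rewrite sumrB.
  have -> : \sum_(i < k) \sum_(j < k) c * ((K * Q%:R) ^+ 2 * ((k.+1 + i + j + 4)%N%:R ^+ 2)^-1)
     = c * Q%:R ^+ 2 * box_sum R k * K ^+ 2.
    rewrite /box_sum mulrAC big_distrr /=; apply: eq_bigr => i _.
    by rewrite big_distrr; apply: eq_bigr => j _ /=; rewrite exprMn; ring.
  have -> : \sum_(i < k) \sum_(j < k) (eta * Q%:R ^+ 2 + (C + 1) * Q%:R) =
     k%:R ^+ 2 * (eta * Q%:R ^+ 2 + (C + 1) * Q%:R).
    by rewrite !sumr_const !card_ord -mulrnA -[LHS]mulr_natl natrM expr2.
  rewrite -addrA -opprD mulrBl lerD2l lerN2 [leRHS]mulrC; apply: ler_wpM2r.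
    by rewrite addr_ge0 ?mulr_ge0 ?exprn_ge0 ?addr_ge0 // ltW.
  by rewrite lerXn2r ?nnegrE // ler_nat.
apply: ler_sum => i _; rewrite natr_sum; apply: ler_sum => j _.
set s := (k.+1 + i + j + 4)%N; set m := (k.+1 * Q %/ s)%N.
have s0 : (0 < s)%N by rewrite /s; lia.
have mQ : (m <= Q)%N.
  apply: (@leq_trans (k.+1 * Q %/ k.+1)%N); last by rewrite mulKn.
  by apply: leq_div2l => //; rewrite /s; lia.
have mQ1 : m%:R <= Q%:R :> R by rewrite ler_nat.
have mQ2 : m%:R ^+ 2 <= Q%:R ^+ 2 :> R by rewrite lerXn2r ?nnegrE.
have sq := @natdiv_sq_ge R (k.+1 * Q) s s0.
have xQ : (k.+1 * Q)%N%:R / s%:R <= Q%:R :> R.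
  rewrite ler_pdivrMr ?ltr0n // natrM mulrC; apply: ler_wpM2l => //.
  by rewrite ler_nat /s; lia.
have : c * ((K * Q%:R) ^+ 2 * (s%:R ^+ 2)^-1) <= c * (m%:R ^+ 2 + 2 * Q%:R).
  apply: ler_wpM2l; first exact: ltW.
  rewrite -exprVn -exprMn -natrM; rewrite -/m in sq; lra.
have : c * (2 * Q%:R) <= Q%:R.
  by rewrite mulrA -[leRHS]mul1r; apply: ler_wpM2r => //; lra.
have := HC m; rewrite ler_norml => /andP[+ _]; rewrite /totient_err.
have : eta * m%:R ^+ 2 <= eta * Q%:R ^+ 2 by apply: ler_wpM2l mQ2; exact: ltW.
have : C * m%:R <= C * Q%:R by apply: ler_wpM2l.
rewrite !mulrDr mulrDl mul1r; lra.
Qed.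

(** The inequality [inverse_pairs_real] is summed over b >= 2, with [sum_tau_sq] for the divisor
    term; the modulus b = 1 is set apart and costs the summand 1. *)
Lemma pair_count_ge_boxes (k q D Q : nat) : (0 < q)%N -> (0 < D)%N ->
  (\sum_(1 <= b < Q.+1) box_count k b Q * totient b)%N%:R / k.+1%:R ^+ 2 <=
  (pair_count Q)%:R + 1 + 2 * k.+1%:R * Q%:R + k.+1%:R ^+ 2 / q%:R * Q%:R ^+ 2
   + 16 * k.+1%:R ^+ 2 * q%:R ^+ 4 * (D%:R * Q%:R + Q%:R ^+ 2 / D%:R) :> R.
Proof.
move=> q0 D0; set K : R := k.+1%:R.
have K2 : 0 < K ^+ 2 by rewrite exprn_gt0 // ltr0n.
have W0 : 0 <= 2 * K ^+ 2 * q%:R ^+ 4 by rewrite !mulr_ge0 ?exprn_ge0.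
case: Q => [|Q].
  rewrite big_geq // mul0r.
  by rewrite !addr_ge0 // !mulr_ge0 ?addr_ge0 ?mulr_ge0 ?invr_ge0 ?exprn_ge0.
set N := Q.+1.
have first_term : (box_count k 1 N * totient 1)%N%:R / K ^+ 2 <= 1 :> R.
  rewrite ler_pdivrMr // mul1r -natrX ler_nat muln1.
  have kk : (\sum_(i < k.+1) \sum_(j < k.+1) 1 = k.+1 ^ 2)%N.
    by rewrite -mulnn !sum_nat_const !card_ord muln1.
  rewrite -kk big_ord_recr /=; apply: leq_trans (leq_addr _ _).
  apply: leq_sum => i _; rewrite big_ord_recr /=; apply: leq_trans (leq_addr _ _).
  by apply: leq_sum => j _; exact: leq_b1.
rewrite big_ltn // natrD mulrDl.
have -> : (pair_count N)%:R + 1 + 2 * K * N%:R + K ^+ 2 / q%:R * N%:R ^+ 2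
   + 16 * K ^+ 2 * q%:R ^+ 4 * (D%:R * N%:R + N%:R ^+ 2 / D%:R) =
   1 + ((pair_count N)%:R + 2 * K * N%:R + K ^+ 2 / q%:R * N%:R ^+ 2
   + 2 * K ^+ 2 * q%:R ^+ 4 * (8 * (N%:R * (D%:R + N%:R / D%:R)))) by ring.
apply: lerD => //.
have tau2 : \sum_(2 <= b < N.+1) (tau b)%:R ^+ 2 <= 8 * (N%:R * (D%:R + N%:R / D%:R)) :> R.
  apply: (@le_trans _ _ (\sum_(1 <= b < N.+1) tau b ^ 2)%N%:R).
    rewrite [X in _ <= X%:R]big_ltn // natrD natr_sum.
    under [X in _ <= _ + X]eq_bigr do rewrite natrX.
    by rewrite lerDr.
  apply: le_trans (_ : (8 * (N * (D + N %/ D)))%N%:R <= _); first by rewrite ler_nat sum_tau_sq.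
  rewrite !natrM natrD; apply: ler_wpM2l => //; apply: ler_wpM2l => //.
  by rewrite lerD2l natdiv_le.
have lin : \sum_(2 <= b < N.+1) b%:R <= N%:R ^+ 2 :> R.
  rewrite -natr_sum -natrX ler_nat.
  apply: (@leq_trans (\sum_(1 <= b < N.+1) N)%N).
    rewrite [leqRHS]big_ltn //; apply: leq_trans (leq_addl _ _).
    by rewrite big_nat [leqRHS]big_nat; apply: leq_sum => b /andP[_]; rewrite ltnS.
  by rewrite sum_nat_const_nat subn1 mulnn.
have cst : \sum_(2 <= b < N.+1) 2 * K <= 2 * K * N%:R.
  rewrite sumr_const_nat -[leLHS]mulr_natr; apply: ler_wpM2l; first by rewrite mulr_ge0.
  by rewrite ler_nat; lia.
apply: (@le_trans _ _ (\sum_(2 <= b < N.+1)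
  ((inverse_pairs b.-2 N)%:R + 2 * K + K ^+ 2 / q%:R * b%:R
    + 2 * K ^+ 2 * q%:R ^+ 4 * (tau b)%:R ^+ 2))).
  rewrite natr_sum mulr_suml; apply: ler_sum_nat => -[|[|b]] // _.
  apply: le_trans (_ : _ <= _); first by rewrite natrM; exact: (@inverse_pairs_real R k b q N q0).
  by rewrite le_eqVlt; apply/orP; left; apply/eqP => /=; rewrite -/K; ring.
rewrite !big_split /=.
apply: lerD; last by rewrite -mulr_sumr; apply: ler_wpM2l.
apply: lerD; last by rewrite -mulr_sumr; apply: ler_wpM2l => //; rewrite divr_ge0 // ltW.
by apply: lerD => //; rewrite /pair_count natr_sum.
Qed.

Theorem pair_count_lower (eps : R) : 0 < eps -> exists2 C : R, 0 <= C &
  forall Q, (ln (4 / 3) / (2 * zeta (2 : R)) - eps) * Q%:R ^+ 2 - C * Q%:R - 1 <= (pair_count Q)%:R.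
Proof.
move=> eps0; have [c0 c1] := andP (half_inv_zeta2_bounds R).
have e2 : 0 < eps / 2 by lra.
have e4 : 0 < eps / 4 by lra.
have [k Hk] := box_sum_lower e2.
have [C C0 HC] := totient_sum_asymptotic e4.
have inv_small (x : R) : 0 <= x -> exists2 q : nat, (0 < q)%N & x / q%:R <= eps / 8.
  move=> x0; exists (Num.truncn (8 * x / eps)).+1 => //.
  rewrite ler_pdivrMr ?ltr0n //.
  have := ltW (truncnS_gt (8 * x / eps)); rewrite ler_pdivrMr //.
  move: (Num.truncn _).+1%:R => t; lra.
(* q depends on k, and D on both. The quadratic losses are eps / 4 from the Riemann sum, since c <=
   1/2, eps / 4 from the totient sums and eps / 8 from each of q and D. *)
have [q q0 Hq] := inv_small (k.+1%:R ^+ 2) (exprn_ge0 _ (ler0n _ _)).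
have x0 : 0 <= 16 * k.+1%:R ^+ 2 * q%:R ^+ 4 :> R by rewrite !mulr_ge0 ?exprn_ge0.
have [D D0 HD] := inv_small _ x0.
set K : R := k.+1%:R in Hq HD x0 *; set X := 16 * K ^+ 2 * q%:R ^+ 4 in HD x0 *.
exists (C + 1 + 2 * K + X * D%:R).
  by rewrite !addr_ge0 ?mulr_ge0.
move=> Q.
have := pair_count_ge_boxes k Q q0 D0; rewrite -/K -/X.
have := sum_box_count_lower k Q e4 C0 HC; rewrite -/K.
move=> h1 h2; have := le_trans h1 h2.
have Q2 : 0 <= Q%:R ^+ 2 :> R by rewrite exprn_ge0.
have h3 : (ln (4 / 3) / (2 * zeta 2) - eps / 4) * Q%:R ^+ 2 <= c * Q%:R ^+ 2 * box_sum R k.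
  rewrite [leRHS]mulrAC; apply: ler_wpM2r => //.
  apply: (@le_trans _ _ (c * (ln (4 / 3) - eps / 2))); last by apply: ler_wpM2l; rewrite // ltW.
  rewrite mulrBr [c * ln _]mulrC lerD2l lerN2; move: c c0 c1 => c' *; nra.
have h4 : K ^+ 2 / q%:R * Q%:R ^+ 2 <= eps / 8 * Q%:R ^+ 2 by apply: ler_wpM2r.
have h5 : X / D%:R * Q%:R ^+ 2 <= eps / 8 * Q%:R ^+ 2 by apply: ler_wpM2r.
have -> : X * (D%:R * Q%:R + Q%:R ^+ 2 / D%:R) = X * D%:R * Q%:R + X / D%:R * Q%:R ^+ 2 by ring.
move: h3 h4 h5; set A := ln (4 / 3) / (2 * zeta 2).
set B := c * Q%:R ^+ 2 * box_sum R k; set T := K ^+ 2 / q%:R * Q%:R ^+ 2.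
set U := X / D%:R * Q%:R ^+ 2; clearbody A B T U.
have : 0 <= eps * Q%:R ^+ 2 by rewrite mulr_ge0 // ltW.
lra.
Qed.
End PairCount.

(** * Saturated Farey fractions *)

Lemma det_mx2 (R : comPzRingType) (M : 'M[R]_2) :
  \det M = M 0 0 * M 1 1 - M 0 1 * M 1 0.
Proof.
rewrite (expand_det_row _ 0) !big_ord_recl big_ord0 addr0 /cofactor !det_mx11 !mxE /=.
rewrite expr0 mul1r expr1 mulN1r mulrN.
by congr (M _ _ * M _ _ - M _ _ * M _ _); apply/val_inj.
Qed.

Lemma tr_mx2 (R : pzSemiRingType) (M : 'M[R]_2) : \tr M = M 0 0 + M 1 1.
Proof.
rewrite /mxtrace big_ord_recl big_ord1; congr (_ + M _ _); exact/val_inj.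
Qed.

Lemma sat_farey_inv (Q : nat) (x : rat) : sat_farey Q x ->
  exists b d : nat, [/\ (0 < d)%N, (0 < b)%N, (b + d <= Q)%N & x = d%:R / b%:R].
Proof.
move=> [M [[_ ab bd d1 _]]]; rewrite tr_mx2 => trM <-.
have [d dE] : exists d : nat, M 1 1 = d.
  by exists `|M 1%R 1%R|%N; rewrite gez0_abs //; lia.
have [b bE] : exists b : nat, M 0 1 = b.
  by exists `|M 0%R 1%R|%N; rewrite gez0_abs //; lia.
exists b, d; rewrite dE bE in ab bd d1 trM *.
move: (M 0 0) ab trM => a ab trM; split => //; lia.
Qed.

(** The witness has a = b + y and c = d + e with d y = 1 + e b, so its determinant is d y - e b = 1
    and its trace is b + d + y. From e b < d y <= b y comes e <= y, whence c <= a. *)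
Lemma sat_farey_intro (Q b d y : nat) : (0 < d <= b)%N -> (0 < y <= b)%N ->
  d * y = 1 %[mod b] -> (1 < b)%N -> (d + y + b <= Q)%N ->
  sat_farey Q (d%:R / b%:R).
Proof.
move=> /andP[d0 db] /andP[y0 yb] dy b1 dQ.
have [e dye] : exists e, (d * y = 1 + e * b)%N.
  exists (d * y %/ b)%N; rewrite {1}(divn_eq (d * y) b) dy modn_small //; lia.
pose M : 'M[int]_2 := \matrix_(i < 2, j < 2)
  if i == 0 then (if j == 0 then (b + y)%N%:Z else b%:Z)
  else (if j == 0 then (d + e)%N%:Z else d%:Z).
have M00 : M 0 0 = (b + y)%N by rewrite !mxE.
have M01 : M 0 1 = b by rewrite !mxE.
have M10 : M 1 0 = (d + e)%N by rewrite !mxE.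
have M11 : M 1 1 = d by rewrite !mxE.
exists M; last by rewrite M01 M11.
split; last by rewrite tr_mx2 M00 M11; lia.
have eb : (e <= y)%N by nia.
split; rewrite ?det_mx2 ?M00 ?M01 ?M10 ?M11; try lia.
Qed.

Definition inverse_pair (Q : nat) (b d : nat) : bool :=
  [&& (1 < b)%N, (0 < d <= b)%N &
   [exists y : 'I_Q.+1, [&& (0 < y <= b)%N, d * y == 1 %[mod b] & (d + y + b <= Q)%N]]].

Lemma inverse_pairs_le (n Q : nat) :
  (inverse_pairs n Q <= \sum_(d < Q.+1) inverse_pair Q n.+2 d)%N.
Proof.
(* For Q < b the range d <= Q does not cover Z/b, but then no x meets the trace bound. *)
have [nQ|Qn] := ltnP Q n.+2.
  rewrite /inverse_pairs big1 // => x _.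
  by rewrite leqNgt (leq_trans nQ) // leq_addl.
rewrite /inverse_pairs.
apply: (@leq_trans (\sum_(d < n.+2) inverse_pair Q n.+2 d)%N); last first.
  rewrite -!(big_mkord xpredT (fun d => nat_of_bool (inverse_pair Q n.+2 d))).
  by rewrite [leqRHS](@big_cat_nat _ _ _ n.+2) ?leq_addr // leqW.
rewrite big_mkcond /=; apply: leq_sum => x _; case: ifP => // Ux.
have [le|//] := boolP (_ + _ + _ <= Q)%N; suff -> : inverse_pair Q n.+2 x by [].
have unit_gt0 (u : 'Z_n.+2) : u \is a GRing.unit -> (0 < u)%N.
  by move=> Uu; rewrite lt0n; apply: contraTneq Uu => u0;
    rewrite (_ : u = 0) ?unitr0 //; exact/val_inj.
have x0 := unit_gt0 _ Ux; have y0 : (0 < x^-1%R)%N by apply: unit_gt0; rewrite unitrV.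
have xb : (x <= n.+2)%N := ltnW (ltn_ord x).
have yb : (x^-1%R <= n.+2)%N := ltnW (ltn_ord x^-1).
rewrite /inverse_pair x0 xb /=; apply/existsP.
have yQ : (x^-1%R < Q.+1)%N by rewrite ltnS; apply: leq_trans le; rewrite addnAC leq_addl.
exists (Ordinal yQ); rewrite /= y0 yb le andbT /=.
have := mulrV Ux; move/(congr1 val) => /= E.
by rewrite E.
Qed.

Lemma farey_inj (b d b' d' : nat) : (0 < b)%N -> (0 < b')%N ->
  coprime d b -> coprime d' b' -> d%:R / b%:R = d'%:R / b'%:R :> rat ->
  (b = b') /\ (d = d').
Proof.
move=> b0 b'0 cdb cdb' E.
have {}E : (d * b' = d' * b)%N.
  apply/eqP; rewrite -(@eqr_nat rat) !natrM.
  by rewrite -eqr_div ?pnatr_eq0 -?lt0n // E.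
have bb : b = b'.
  apply/eqP; rewrite eqn_dvd; apply/andP; split.
    by rewrite -(@Gauss_dvdr _ d) 1?coprime_sym // E dvdn_mull.
  by rewrite -(@Gauss_dvdr _ d') 1?coprime_sym // -E dvdn_mull.
by split=> //; apply/eqP; rewrite -(eqn_pmul2r b0) {1}bb E.
Qed.

(** An invertible d is coprime to b, so d / b is reduced and distinct pairs give distinct fractions,
    although [sat_farey] ignores multiplicity. *)
Lemma pair_count_le_sat_card (Q : nat) : (pair_count Q <= sat_card Q)%N.
Proof.
pose f (p : 'I_Q.+1 * 'I_Q.+1) : rat := (p.2 : nat)%:R / (p.1 : nat)%:R.
pose S := [pred p : 'I_Q.+1 * 'I_Q.+1 | inverse_pair Q p.1 p.2].
have SP p : p \in S -> exists y, [/\ (1 < p.1)%N, (0 < p.2 <= p.1)%N, (0 < y <= p.1)%N,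
    p.2 * y = 1 %[mod p.1] & (p.2 + y + p.1 <= Q)%N].
  by move=> /and3P[h1 h2 /existsP[y /and3P[h3 /eqP h4 h5]]]; exists y.
apply: (@leq_trans #|S|).
  have -> : #|S| = (\sum_(b < Q.+1) \sum_(d < Q.+1) inverse_pair Q b d)%N.
    rewrite pair_bigA /= -sum1_card big_mkcond; apply: eq_bigr => p _.
    by rewrite -topredE /=; case: inverse_pair.
  rewrite -(big_mkord xpredT (fun b => \sum_(d < Q.+1) inverse_pair Q b d)%N).
  rewrite /pair_count; have [Q1|Q1] := ltnP Q 2; first by rewrite big_geq.
  rewrite [leqRHS](@big_cat_nat _ _ _ 2) ?(leqW Q1) //=; apply: leq_trans (leq_addl _ _).
  by rewrite big_nat [leqRHS]big_nat; apply: leq_sum => -[|[|b]] // _; exact: inverse_pairs_le.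
rewrite cardE -(size_map f); apply: uniq_leq_size.
  rewrite map_inj_in_uniq ?enum_uniq // => p p'; rewrite !mem_enum.
  move=> /SP[y [h1 h2 h3 h4 h5]] /SP[y' [h1' h2' h3' h4' h5']] E.
  have cop (b d z : nat) : (1 < b)%N -> d * z = 1 %[mod b] -> coprime d b.
    move=> b1 dz; have : coprime (d * z) b.
      by rewrite -coprime_modl dz coprime_modl coprime1n.
    by rewrite coprimeMl => /andP[].
  have [] := farey_inj (ltnW h1) (ltnW h1') (cop _ _ _ h1 h4) (cop _ _ _ h1' h4') E.
  by case: p p' {h1 h2 h3 h4 h5 h1' h2' h3' h4' h5' E} => [p1 p2] [p1' p2'] /= /val_inj -> /val_inj ->.
move=> _ /mapP[p + ->]; rewrite mem_enum => /SP[y [h1 h2 h3 h4 h5]].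
rewrite in_fset_set; last exact: finite_sat_farey.
by rewrite inE; exact: (sat_farey_intro h2 h3 h4 h1 h5).
Qed.

(** * Small gaps and their left ends *)

Lemma farey_gap (b d b' d' Q : nat) : (0 < b)%N -> (0 < b')%N -> (b' <= Q)%N ->
  d%:R / b%:R < d'%:R / b'%:R :> rat ->
  (b%:R * Q%:R)^-1 <= d'%:R / b'%:R - d%:R / b%:R :> rat.
Proof.
move=> b0 b'0 bQ lt.
have B0 : 0 < b%:R :> rat by rewrite ltr0n.
have B'0 : 0 < b'%:R :> rat by rewrite ltr0n.
have : (d * b' + 1 <= d' * b)%N.
  move: lt; rewrite ltr_pdivrMr // mulrAC ltr_pdivlMr // -!natrM ltr_nat; lia.
rewrite -(ler_nat rat) natrD !natrM => H.
apply: (@le_trans _ _ (b%:R * b'%:R)^-1).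
  rewrite lef_pV2 ?posrE ?mulr_gt0 ?ltr0n //; last exact: leq_trans bQ.
  by apply: ler_wpM2l => //; rewrite ler_nat.
have -> : d'%:R / b'%:R - d%:R / b%:R = (d'%:R * b%:R - d%:R * b'%:R) / (b%:R * b'%:R) :> rat.
  by field; rewrite !gt_eqF.
rewrite -[leLHS]mul1r; apply: ler_wpM2r; last lra.
by rewrite invr_ge0 mulr_ge0.
Qed.

Section Gaps.
Variable R : realType.

Lemma small_gap_left (Q : nat) (lambda : R) (p : rat * rat) :
  sat_small_gaps Q lambda p -> exists b d : nat,
  [/\ (0 < b)%N, (b + d <= Q)%N, p.1 = d%:R / b%:R &
      (b%:R * Q%:R)^-1 <= lambda / (sat_card Q)%:R].
Proof.
move=> [[/sat_farey_inv[b [d [_ b0 bd E]]] /sat_farey_inv[b' [d' [_ b'0 bd' E']]] lt _] le].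
exists b, d; split => //; apply: le_trans le.
have -> : (b%:R * Q%:R)^-1 = ratr ((b%:R * Q%:R)^-1) :> R.
  by rewrite fmorphV rmorphM !rmorph_nat.
rewrite ler_rat E E'; apply: farey_gap => //; last by rewrite -E -E'.
by apply: leq_trans bd'; exact: leq_addr.
Qed.

(** A consecutive pair is determined by its left end d / b, and d <= Q - b <= m leaves m + 1
    numerators and Q + 1 denominators. *)
Lemma small_gaps_card (Q m : nat) (lambda : R) :
  (forall b, (b <= Q)%N -> (b%:R * Q%:R)^-1 <= lambda / (sat_card Q)%:R ->
     (0 < b)%N -> (Q - b <= m)%N) ->
  (#|` fset_set (sat_small_gaps Q lambda)| <= m.+1 * Q.+1)%N.
Proof.
move=> Hm; set G := fset_set _.
have GP p : p \in G -> sat_small_gaps Q lambda p.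
  by rewrite in_fset_set; [rewrite inE | exact: finite_sat_small_gaps].
pose f (p : 'I_m.+1 * 'I_Q.+1) : rat := (p.1 : nat)%:R / (p.2 : nat)%:R.
have -> : (m.+1 * Q.+1 = size (map f (enum {: 'I_m.+1 * 'I_Q.+1})))%N.
  by rewrite size_map -cardE card_prod !card_ord.
rewrite -(size_map fst); apply: uniq_leq_size.
  rewrite map_inj_in_uniq ?fset_uniq // => -[x y] [x' y'] /GP[[Sx Sy xy nxy] _].
  move=> /GP[[Sx' Sy' xy' nxy'] _] /= xx'.
  move: Sx Sy xy nxy Sx' Sy' xy' nxy'; rewrite /= -{}xx' => Sx Sy xy nxy _ Sy' xy' nxy'.
  congr (_, _); have [lt|gt|//] := ltgtP y y'.
    by have := nxy' _ Sy; rewrite xy lt.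
  by have := nxy _ Sy'; rewrite xy' gt.
move=> _ /mapP[p /GP /small_gap_left[b [d [b0 bd E le]]] ->].
have bQ : (b <= Q)%N by apply: leq_trans bd; exact: leq_addr.
have dm : (d < m.+1)%N by rewrite ltnS; apply: leq_trans (Hm _ bQ le b0); lia.
rewrite -ltnS in bQ; apply/mapP; exists (Ordinal dm, Ordinal bQ) => //.
exact: mem_enum.
Qed.

Local Notation A := (ln (4 / 3) / (2 * zeta (2 : R))).

Lemma saturated_density_gt0 : 0 < A.
Proof.
have := zeta2_ge1 R => z1; rewrite divr_gt0 //; last lra.
by rewrite ln_gt0 //; lra.
Qed.

Lemma gap_distr_small (lambda eps : R) : 0 <= lambda <= A -> 0 < eps ->
  \forall Q \near \oo, gap_distr Q lambda <= eps.
Proof.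
move=> /andP[l0 lA] e0; have := saturated_density_gt0.
have lower := @pair_count_lower R; move: lA lower; set a := A => lA lower a0.
(* The first bound keeps N(Q) >= (a / 2) Q^2 up to lower order; the second makes delta / a, the
   proportion of denominators left, at most eps a / 8. *)
pose delta := Num.min (a / 2) (eps * a ^+ 2 / 8).
have ea0 : 0 < eps * a by rewrite mulr_gt0.
have delta0 : 0 < delta.
  by rewrite lt_min divr_gt0 //= divr_gt0 // mulr_gt0 // exprn_gt0.
have [C C0 HC] := lower _ delta0.
have d1 : delta <= a / 2 by rewrite ge_min lexx.
have d2 : delta / a <= eps * a / 8.
  rewrite ler_pdivrMr //; have : delta <= eps * a ^+ 2 / 8 by rewrite ge_min lexx orbT.
  by move/le_trans; apply; rewrite le_eqVlt; apply/orP; left; apply/eqP; ring.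
pose C' := (C + 1) / a + 1.
have C'0 : 0 <= C' by rewrite addr_ge0 // divr_ge0 ?addr_ge0 // ltW.
(* Threshold for the final quadratic inequality in Q: the coefficient 3/8 is 1/2 - 1/8, and constant
   terms are bounded by their multiples by Q >= 1. *)
pose T := (eps * a / 8 + 2 * C' + eps * C + eps) / (3 / 8 * (eps * a)).
exists (Num.truncn T).+1 => // Q /= TQ.
have Q0 : (0 < Q)%N by apply: leq_trans TQ.
have {}TQ : T <= Q%:R.
  by apply: le_trans (ltW (truncnS_gt T)) _; rewrite ler_nat.
have {TQ} : eps * a / 8 + 2 * C' + eps * C + eps <= Q%:R * (3 / 8 * (eps * a)).
  by rewrite -ler_pdivrMr //; lra.
move=> TQ; have Q1 : 1 <= Q%:R :> R by rewrite ler1n.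
have Qpos : 0 < Q%:R :> R by rewrite ltr0n.
have HN : (a - delta) * Q%:R ^+ 2 - C * Q%:R - 1 <= (sat_card Q)%:R.
  by apply: le_trans (HC Q) _; rewrite ler_nat pair_count_le_sat_card.
set N : R := (sat_card Q)%:R in HN *.
(* Bound for Q - b: compare N <= a b Q, forced by the small gap, with N >= (a - delta) Q^2 - C Q - 1
   and divide by a Q. *)
pose z := (delta * Q%:R + C + 1) / a.
have z0 : 0 <= z.
  by rewrite divr_ge0 ?(ltW a0) // !addr_ge0 // mulr_ge0 // ltW.
have card : (#|` fset_set (sat_small_gaps Q lambda)|)%:R <= (z + 1) * (Q%:R + 1) :> R.
  apply: (@le_trans _ _ ((Num.truncn z).+1 * Q.+1)%N%:R).
    rewrite ler_nat; apply: small_gaps_card => b bQ le b0.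
    rewrite truncn_ge_nat // natrB // /z ler_pdivlMr //.
    have B0 : 0 < b%:R :> R by rewrite ltr0n.
    have bQ0 : 0 < b%:R * Q%:R :> R by rewrite mulr_gt0.
    have N0 : 0 < N.
      rewrite lt_def [0 <= N]ler0n andbT; apply/negP => /eqP NE.
      by move: le; rewrite -/N NE invr0 mulr0 leNgt invr_gt0 bQ0.
    have NbQ : N <= a * (b%:R * Q%:R).
      move: le; rewrite -/N ler_pdivlMr // ler_pdivrMl // => h.
      by apply: le_trans h _; rewrite mulrC; apply: ler_wpM2r => //; exact: ltW.
    rewrite -(@ler_pM2r _ Q%:R) //.
    move: HN NbQ; rewrite expr2 => h1 h2; have := le_trans h1 h2; lra.
  rewrite natrM -!natr1; apply: ler_wpM2r; first by rewrite addr_ge0.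
  by rewrite lerD2r truncn_le.
(* For N(Q) = 0 the quotient defining [gap_distr] is 0, division by zero being 0. *)
have [N0|N0] := leP N 0.
  rewrite /gap_distr -/N (_ : N = 0) ?invr0 ?mulr0 ?ltW //.
  by apply/eqP; rewrite eq_le N0 ler0n.
rewrite /gap_distr -/N ler_pdivrMr //; apply: le_trans card _.
have zle : z <= eps * a / 8 * Q%:R + (C + 1) / a.
  have -> : z = delta / a * Q%:R + (C + 1) / a by rewrite /z; field; rewrite gt_eqF.
  by rewrite lerD2r; apply: ler_wpM2r.
have s1 : (z + 1) * (Q%:R + 1) <= (eps * a / 8 * Q%:R + C') * (Q%:R + 1).
  by apply: ler_wpM2r; rewrite ?addr_ge0 // /C'; lra.
have s2 : eps * ((a / 2) * Q%:R ^+ 2 - C * Q%:R - 1) <= eps * N.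
  apply: ler_wpM2l; first exact: ltW.
  apply: le_trans HN; rewrite !lerD2r; apply: ler_wpM2r; first by rewrite exprn_ge0.
  lra.
apply: le_trans s1 _; apply: le_trans s2.
have s3 := ler_wpM2l (ltW Qpos) TQ.
have s4 : C' + eps <= (C' + eps) * Q%:R.
  by rewrite -[leLHS]mulr1; apply: ler_wpM2l => //; rewrite addr_ge0 // ltW.
lra.
Qed.

End Gaps.

Theorem mainTheorem6 (R : realType) (lambda : R)
  (lambda_ge0 : 0 <= lambda)
  (lambda_le : lambda <= ln (4 / 3) / (2 * zeta (2 : R))) :
  cvgn (fun Q : nat => gap_distr Q lambda) /\ limit_gap_distr lambda = 0.
Proof.
have to0 : gap_distr Q lambda @[Q --> \oo] --> (0 : R).
  apply/cvgrPdist_le => eps eps0.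
  have := @gap_distr_small R lambda eps; rewrite lambda_ge0 => /(_ lambda_le eps0).
  apply: filterS => Q; rewrite sub0r normrN ger0_norm // /gap_distr.
  by rewrite divr_ge0.
split; last exact: cvg_lim to0.
by apply/cvg_ex; exists 0.
Qed.
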